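(* Let $T>0$ and let $a\colon[0,T]\to\mathbb{R}$ be a Lebesgue integrable function. Assume there exists an interval $J\subseteq[0,T]$ where $a(x)\ge0$ for a.e. $x\in J$ and also \[ \int_{0}^{T}a(x)\,dx<0<\int_{J}a(x)\,dx. \] Let $g\colon\mathbb{R}^{+}\to\mathbb{R}^{+}$ be continuously differentiable, with $g(0)=0$ and $g(s)>0$ for all $s>0$, such that $g'(0)=0$ and the limit $g'(+\infty):=\lim_{s\to+\infty}g'(s)$ exists with $0<g'(+\infty)<+\infty$. Then there exists $\nu^{*}>0$ such that for each $\nu>\nu^{*}$ the problem \[ u''+\nu\,a(x)g(u)=0\ \text{ on } (0,T),\qquad \mathscr{B}(u,u')=\underline{0}, \] has at least one positive solution, where $\mathscr{B}(u,u')=\underline{0}$ denotes either of the two boundary conditions (Neumann or periodic) described in the context.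
   Context: $\mathbb{R}^{+}=[0,+\infty)$. The boundary operator is either $\mathscr{B}(u,u')=(u'(0),u'(T))$ (Neumann) or $\mathscr{B}(u,u')=(u(T)-u(0),u'(T)-u'(0))$ (periodic); the statement holds for each of the two choices. A solution is a continuously differentiable function $u\colon[0,T]\to\mathbb{R}$ with $u'$ absolutely continuous, satisfying the equation for a.e. $x\in[0,T]$ and the boundary condition. A positive solution is a solution with $u(x)>0$ for every $x\in[0,T]$. *)

(* Defs.v *)
From mathcomp Require Export all_boot all_order all_algebra.
From mathcomp Require Export all_classical all_reals all_analysis.

Set Implicit Arguments.
Unset Strict Implicit.
Unset Printing Implicit Defensive.

Import Order.TTheory GRing.Theory Num.Theory.
Import numFieldNormedType.Exports.

Local Open Scope classical_set_scope.
Local Open Scope ring_scope.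

(* In mathcomp-analysis, [lebesgue_measure] is defined on Borel sets only; its
   completion gives "Lebesgue measurable", "Lebesgue integrable" and "almost
   everywhere" their usual meaning. *)
Notation leb R := (@completed_lebesgue_measure R).

Section Derivative.
Context {R : realType}.
Implicit Types (D : set R) (f : R -> R) (x : R).

(* Functions defined on a closed interval D are represented by total functions
   of which only the values on D matter: the difference quotient is restricted
   to D, so that the derivative at an endpoint of D is one-sided. *)
Definition quotients D f x : set_system R :=
  (f y - f x) / (y - x) @[y --> within D x^'].

Definition derivable_on D f x : Prop := cvg (quotients D f x).

Definition derive_on D f x : R := lim (quotients D f x).

Definition continuously_differentiable_on D f : Prop :=
  (forall x, D x -> derivable_on D f x) /\ {within D, continuous (derive_on D f)}.

Definition absolutely_continuous_on (a b : R) f : Prop :=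
  forall e : R, 0 < e -> exists2 d : R, 0 < d &
    forall (n : nat) (s t : 'I_n -> R),
      (forall i, a <= s i /\ s i <= t i /\ t i <= b) ->
      trivIset setT (fun i => `]s i, t i[%classic) ->
      \sum_(i < n) (t i - s i) < d ->
      \sum_(i < n) `|f (t i) - f (s i)| < e.

End Derivative.

Variant boundary_condition := Neumann | Periodic.

Section BoundaryValueProblem.
Context {R : realType}.

Definition boundary_operator (bc : boundary_condition) (T : R) (u u' : R -> R) :
    R * R :=
  match bc with
  | Neumann => (u' 0, u' T)
  | Periodic => (u T - u 0, u' T - u' 0)
  end.

(* Solutions of u'' + h(x, u) = 0 on (0, T) with B(u, u') = 0. *)
Definition solution (bc : boundary_condition) (T : R) (h : R -> R -> R)
    (u : R -> R) : Prop :=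
  let I := `[0, T]%classic in
  let u' := derive_on I u in
  [/\ continuously_differentiable_on I u,
      absolutely_continuous_on 0 T u',
      {ae leb R, forall x : R, I x ->
         derivable_on I u' x /\ derive_on I u' x + h x (u x) = 0} &
      boundary_operator bc T u u' = (0, 0)].

Definition positive_solution (bc : boundary_condition) (T : R)
    (h : R -> R -> R) (u : R -> R) : Prop :=
  solution bc T h u /\ forall x, 0 <= x <= T -> 0 < u x.

End BoundaryValueProblem.

(* Main.v *)
(** Extend [g] by 0 to the negative reals and solve the initial value problem
    [u(0) = s], [u'(0) = y] on [0, T]; the map [(s, y) |-> (u(T), u'(T))] is
    Lipschitz. With this extension, a solution starting at [s >= 0] that reaches a
    nonpositive value after time 0 satisfies [u(T) <= 0] and [u'(T) < 0], unless it
    starts with [s = 0 >= y]; hence a solution of the boundary value problem with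
    [s > 0] is positive.
    For large data, [u] must reach 0: on [J] a positive solution is concave, and if
    [nu] is large the linear growth of [g] at infinity is incompatible with
    concavity. For small data, [g'(0) = 0] makes [u] almost constant, so
    [u'(T) - u'(0)] has the sign of [- int a > 0].
    In the Neumann case, the intermediate value theorem applied to
    [s |-> u'(T)], with [y = 0], concludes. In the periodic case we need a common
    zero of [F1 = u(T) - s] and [F2 = u'(T) - y] on the region [s >= 0],
    [r <= s + |y| <= R]: there [F1 <= 0] for [s + |y| = R] and for [s = 0 > y];
    [F2 < 0] where [F1 = 0] for [s = 0 < y]; and [F2 > 0] where [F1 = 0] for
    [s + |y| = r]. So [(F1, F2)] has nonzero winding number along the boundary, which
    is detected by a discrete count of crossings. *)
Require Import Defs.
From mathcomp Require Import measurable_realfun ring lra.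
Set Implicit Arguments.
Unset Strict Implicit.
Unset Printing Implicit Defensive.
Import Order.TTheory GRing.Theory Num.Theory.
Import numFieldNormedType.Exports.
Local Open Scope classical_set_scope.
Local Open Scope ring_scope.

(** Existence and stability for the initial value problem both rest on one estimate: in a norm
    weighted by an exponential, steep enough for the merely integrable coefficient, the integral
    operator of the equation has norm at most 1/2 on all of [0, T]. This requires a globally
    Lipschitz nonlinearity; [g'] is bounded because it is continuous with a finite limit. Stability
    is used forwards and backwards in time: the backward form carries a bound, or a double zero, at
    an interior time back to the initial data. Since [a] is measurable only for the completed
    sigma-algebra, it is replaced by an almost everywhere equal Borel function that vanishes outside
    ]0, T] and is nonnegative at every point of [J]. Solutions are kept in integrated form, a second
    function standing for [u']; Lebesgue differentiation restores the equation almost everywhere at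
    the end. The threshold [nu^*] comes from the large-data estimate alone; the radii [r] and [R]
    are chosen afterwards and depend on [nu]. In the periodic case the sign of [F2] is known only
    where [F1 = 0], so the argument counts sign changes of [F1] and consults [F2] only at them. *)

(** * Lipschitz maps, clamping, and derivatives in epsilon form *)

Lemma lipschitz_within_continuous (R : realType) (V : normedModType R)
    (A : set V) (f : V -> R) (K : R) :
  (forall x y, A x -> A y -> `|f x - f y| <= K * `|x - y|) ->
  {within A, continuous f}.
Proof.
move=> fK; apply/subspace_continuousP => x Ax.
apply/cvgrPdist_lt => e e0.
have K1 : 0 < `|K| + 1 by rewrite ltr_wpDl.
near=> y.
have Ay : A y by near: y; exact: withinT.
apply: (le_lt_trans (fK _ _ Ax Ay)).
apply: (@le_lt_trans _ _ ((`|K| + 1) * `|x - y|)).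
  by rewrite ler_wpM2r// (le_trans (ler_norm K))// lerDl.
rewrite mulrC -ltr_pdivlMr//.
near: y; apply: cvg_within.
by apply: (@cvgr_dist_lt _ _ _ _ _ id x) => //; rewrite divr_gt0.
Unshelve. all: by end_near. Qed.

Lemma lipschitz_continuous (R : realType) (f : R -> R) (K : R) :
  (forall x y, `|f x - f y| <= K * `|x - y|) -> continuous f.
Proof.
move=> fK; apply/continuous_subspace_setT.
by apply: (@lipschitz_within_continuous _ _ _ _ K) => x y _ _; exact: fK.
Qed.

(** Composing with a clamp turns a function known on an interval into one that is continuous on the
    whole line. *)
Lemma lipschitz_clamp (R : realType) (c d x y : R) :
  `|Num.min (Num.max x c) d - Num.min (Num.max y c) d| <= `|x - y|.
Proof.
have H u v : u <= v ->
    `|Num.min (Num.max u c) d - Num.min (Num.max v c) d| <= v - u.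
  move=> uv; rewrite ler_norml /Num.min /Num.max.
  by do !case: ifP => //; do ?[move/negbT; rewrite -leNgt => ?|move=> ?]; lra.
have [xy|yx] := lerP x y; first exact: H.
by rewrite distrC H// ltW.
Qed.

Lemma is_derive_eps (R : realType) (f : R -> R) (x l : R) :
  (forall e, 0 < e -> exists2 d, 0 < d & forall y, `|y - x| < d ->
     `|f y - f x - l * (y - x)| <= e * `|y - x|) ->
  is_derive x 1 f l.
Proof.
move=> fl.
suff cvgl : h^-1 *: (f (h *: 1 + x) - f x) @[h --> 0^'] --> l.
  by apply: DeriveDef; [apply/cvg_ex; exists l|exact/cvg_lim].
apply/cvgrPdist_le => e e0; have [d d0 fd] := fl _ e0.
near=> h.
have h0 : h != 0 by near: h; exact: nbhs_dnbhs_neq.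
have hd : `|h| < d by near: h; exact: dnbhs0_lt.
have := fd (h + x); rewrite addrK => /(_ hd) {}fd.
rewrite [h *: 1]mulr1 -[_ *: _]/(_ * _) -(ler_pM2r (_ : 0 < `|h|)) ?normr_gt0//.
rewrite -normrM; apply: le_trans fd.
by rewrite -normrN mulrBl mulrAC mulVf// mul1r opprB.
Unshelve. all: by end_near. Qed.

(** * Common zeros of two functions on a square *)

Definition sg (b : bool) : int := (b : nat)%:Z.

(** The [s] are the signs of [F1], the [q] those of [F2], at the corners of a grid cell. If [F1] has
    one sign on the cell, every difference is 0; otherwise the hypotheses make the [q] equal and the
    differences cancel around the cell. *)
Lemma crossing_balance (s s1 s2 s3 q q1 q2 q3 : bool) :
  (s != s1 -> [/\ q = q1, q = q2 & q = q3]) ->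
  (s != s2 -> [/\ q = q1, q = q2 & q = q3]) ->
  (s != s3 -> [/\ q = q1, q = q2 & q = q3]) ->
  ((sg s1 - sg s) * sg q - (sg s3 - sg s2) * sg q2) +
  ((sg s3 - sg s1) * sg q1 - (sg s2 - sg s) * sg q) = 0.
Proof.
move=> h1 h2 h3.
have [<-|/h1[<- <- _]] := eqVneq s s1; last by ring.
have [<-|/h2[<- <- _]] := eqVneq s s2; last by ring.
have [<-|/h3[<- <- _]] := eqVneq s s3; last by ring.
by ring.
Qed.

Section planar.
Variable R : realType.
Variables (F1 F2 : R -> R -> R) (K : R).
Let I01 := [set x : R | 0 <= x <= 1].
Hypothesis F1K : forall p q p' q', I01 p -> I01 q -> I01 p' -> I01 q' ->
  `|F1 p q - F1 p' q'| <= K * (`|p - p'| + `|q - q'|).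
Hypothesis F2K : forall p q p' q', I01 p -> I01 q -> I01 p' -> I01 q' ->
  `|F2 p q - F2 p' q'| <= K * (`|p - p'| + `|q - q'|).

(** By compactness the sum |F1| + |F2| attains its minimum, which is positive when there is no
    common zero. *)
Lemma planar_gap :
  (forall p q, I01 p -> I01 q -> F1 p q = 0 -> F2 p q = 0 -> False) ->
  exists2 d : R, 0 < d &
    forall p q, I01 p -> I01 q -> d <= `|F1 p q| + `|F2 p q|.
Proof.
move=> noz.
pose A : set (R * R) := `[0, 1] `*` `[0, 1].
have A0 : A !=set0 by exists (0, 0); split; rewrite /= in_itv/= lexx ler01.
have cA : compact A by apply: compact_setX; exact: segment_compact.
pose f (z : R * R) := `|F1 z.1 z.2| + `|F2 z.1 z.2|.
have cf : {within A, continuous f}.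
  apply: (@lipschitz_within_continuous _ _ _ _ (4 * `|K|)) => -[p q] [p' q'].
  rewrite /A /= !in_itv/= => -[p01 q01] [p'01 q'01].
  have h1 := F1K p01 q01 p'01 q'01; have h2 := F2K p01 q01 p'01 q'01.
  have h3 : `|p - p'| <= `|(p, q) - (p', q')| by rewrite /Num.norm/= le_max lexx.
  have h4 : `|q - q'| <= `|(p, q) - (p', q')|.
    by rewrite {2}/Num.norm/= le_max lexx orbT.
  rewrite /f /=.
  have h5 := ler_dist_dist (F1 p q) (F1 p' q').
  have h6 := ler_dist_dist (F2 p q) (F2 p' q').
  set N := `|(p, q) - (p', q')| in h3 h4 *.
  have h7 : K * (`|p - p'| + `|q - q'|) <= `|K| * (2 * N).
    apply: le_trans (_ : `|K| * (`|p - p'| + `|q - q'|) <= _).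
      by rewrite ler_wpM2r ?addr_ge0// ler_norm.
    by rewrite ler_wpM2l//; lra.
  have h8 := ler_normD (`|F1 p q| - `|F1 p' q'|) (`|F2 p q| - `|F2 p' q'|).
  rewrite opprD addrACA; lra.
have [[p q] + minf] := compact_EVT_min A0 cA cf.
rewrite inE => -[/= /[!in_itv]/= p01 q01].
exists (f (p, q)); last first.
  move=> p' q' p'01 q'01; apply: (minf (p', q')).
  by rewrite inE; split; rewrite /= in_itv.
rewrite /f/= lt_neqAle addr_ge0// andbT eq_sym paddr_eq0// !normr_eq0.
by apply/negP => /andP[/eqP ? /eqP ?]; exact: (noz p q).
Qed.

Hypothesis left0 : F1 0 0 <= 0.
Hypothesis left1 : 0 < F1 0 1.
Hypothesis leftP : forall q, I01 q -> F1 0 q = 0 -> 0 < F2 0 q.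
Hypothesis rightP : forall q, I01 q -> F1 1 q <= 0.
Hypothesis bottomP : forall p, I01 p -> F1 p 0 <= 0.
Hypothesis topP : forall p, I01 p -> F1 p 1 = 0 -> F2 p 1 < 0.

(* Count the signed crossings of [F1 = 0] that happen where [F2 > 0]. On a fine
   grid the count around each cell is 0, because [F1] and [F2] are not small
   together, so the count around the square is 0 as well; but the left side
   contributes exactly 1 and the other three sides nothing. *)
Theorem planar_zero :
  exists p q, [/\ I01 p, I01 q, F1 p q = 0 & F2 p q = 0].
Proof.
apply: contrapT => noz.
have [p q p01 q01 e1 e2|d d0 gap] := planar_gap.
  by apply: noz; exists p, q.
(* The mesh is so fine that moving to an adjacent grid point, in one or both coordinates, changes
   [F1] and [F2] by less than half of the gap [d]. *)
pose n := (Num.truncn (4 * `|K| / d)).+1.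
have n0 : 0 < n%:R :> R by rewrite ltr0n.
have nK : `|K| * (2 / n%:R) < d / 2.
  rewrite mulrA ltr_pdivrMr//.
  have := truncnS_gt (4 * `|K| / d); rewrite -/n ltr_pdivrMr// => ?.
  lra.
pose x (i : nat) : R := i%:R / n%:R.
have x01 i : (i <= n)%N -> I01 (x i).
  move=> lein; rewrite /I01/= divr_ge0 ?ler0n//=.
  by rewrite ler_pdivrMr// mul1r ler_nat.
have x0 : x 0%N = 0 by rewrite /x mul0r.
have xn : x n = 1 by rewrite /x divff// gt_eqF.
have xS i : x i.+1 - x i = n%:R^-1 by rewrite /x -mulrBl -natrB// subSnn mul1r.
pose near2 (i i' : nat) := (i' == i) || (i' == i.+1) || (i == i'.+1).
have xnear i i' : near2 i i' -> `|x i - x i'| <= n%:R^-1.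
  move=> /orP[/orP[]|] /eqP ->.
  - by rewrite subrr normr0 invr_ge0 ltW.
  - by rewrite distrC xS ger0_norm// invr_ge0 ltW.
  - by rewrite xS ger0_norm// invr_ge0 ltW.
have osc (F : R -> R -> R) : (forall p q p' q', I01 p -> I01 q -> I01 p' ->
    I01 q' -> `|F p q - F p' q'| <= K * (`|p - p'| + `|q - q'|)) ->
  forall i j i' j', (i <= n)%N -> (j <= n)%N -> (i' <= n)%N -> (j' <= n)%N ->
    near2 i i' -> near2 j j' -> `|F (x i) (x j) - F (x i') (x j')| < d / 2.
  move=> FK i j i' j' hi hj hi' hj' ii' jj'; apply: le_lt_trans nK.
  apply: le_trans (FK _ _ _ _ (x01 _ hi) (x01 _ hj) (x01 _ hi') (x01 _ hj')) _.
  apply: le_trans (_ : `|K| * (`|x i - x i'| + `|x j - x j'|) <= _).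
    by rewrite ler_wpM2r ?addr_ge0// ler_norm.
  by rewrite ler_wpM2l//; have := xnear _ _ ii'; have := xnear _ _ jj'; lra.
pose S i j := 0 < F1 (x i) (x j).
pose Q i j := 0 < F2 (x i) (x j).
have small (F : R -> R -> R) i j i' j' :
    `|F (x i) (x j) - F (x i') (x j')| < d / 2 ->
    (0 < F (x i) (x j)) != (0 < F (x i') (x j')) -> `|F (x i) (x j)| < d / 2.
  move=> h; case: ltrP => h1; case: ltrP => h2 //= _.
    by rewrite gtr0_norm//; move: h; rewrite ltr_norml => /andP[_]; lra.
  by rewrite ler0_norm//; move: h; rewrite ltr_norml => /andP[+ _]; lra.
(* If both functions changed sign near the grid point [(i, j)], both would be smaller than [d / 2]
   there, against the gap. *)
have cell i j i1 j1 i2 j2 : (i <= n)%N -> (j <= n)%N -> (i1 <= n)%N ->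
    (j1 <= n)%N -> (i2 <= n)%N -> (j2 <= n)%N -> 
    near2 i i1 -> near2 i i2 -> near2 j j1 -> near2 j j2 ->
    S i j != S i1 j1 -> Q i j = Q i2 j2.
  move=> hi hj hi1 hj1 hi2 hj2 n1 n2 m1 m2 Sne; apply/eqP.
  apply: contrapT => /negP Qne.
  have a1 := small F1 _ _ _ _ (osc _ F1K _ _ _ _ hi hj hi1 hj1 n1 m1) Sne.
  have a2 := small F2 _ _ _ _ (osc _ F2K _ _ _ _ hi hj hi2 hj2 n2 m2) Qne.
  by have := gap _ _ (x01 _ hi) (x01 _ hj); lra.
(* The signed change of sign of [F1] along an edge, counted only if [F2 > 0] at its starting
   point. *)
pose om i j i' j' := (sg (S i' j') - sg (S i j)) * sg (Q i j).
pose hh i j := om i j i.+1 j.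
pose vv i j := om i j i j.+1.
have near2S k : near2 k k.+1 by rewrite /near2 eqxx orbT.
have near2r k : near2 k k by rewrite /near2 eqxx.
have cell0 i j : (i < n)%N -> (j < n)%N ->
    (hh i j - hh i j.+1) + (vv i.+1 j - vv i j) = 0.
  move=> hi hj; have hi' := ltnW hi; have hj' := ltnW hj.
  have C i1 j1 i2 j2 : (i1 <= n)%N -> (j1 <= n)%N -> (i2 <= n)%N ->
      (j2 <= n)%N -> near2 i i1 -> near2 j j1 -> near2 i i2 -> near2 j j2 ->
      S i j != S i1 j1 -> Q i j = Q i2 j2.
    by move=> *; exact: (@cell i j i1 j1 i2 j2).
  have D i1 j1 : (i1 <= n)%N -> (j1 <= n)%N -> near2 i i1 -> near2 j j1 ->
      S i j != S i1 j1 ->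
      [/\ Q i j = Q i.+1 j, Q i j = Q i j.+1 & Q i j = Q i.+1 j.+1].
    by move=> *; split; apply: (C i1 j1).
  by apply: crossing_balance; [exact: (D i.+1 j)|exact: (D i j.+1)|
    exact: (D i.+1 j.+1)].
have bot i : (i < n)%N -> hh i 0%N = 0.
  move=> hi; rewrite /hh /om /S x0.
  by rewrite !ltNge !bottomP ?mul0r//; apply: x01; rewrite // ltnW.
have right j : (j < n)%N -> vv n j = 0.
  move=> hj; rewrite /vv /om /S xn.
  by rewrite !ltNge !rightP ?mul0r//; apply: x01; rewrite // ltnW.
have zero (f : R -> R) i :
    (forall p q, I01 p -> I01 q -> `|f p - f q| <= K * `|p - q|) ->
    (i < n)%N -> (0 < f (x i)) != (0 < f (x i.+1)) ->
    exists2 z, x i <= z <= x i.+1 & f z = 0.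
  move=> fK hi sgn; have lex : x i <= x i.+1.
    by rewrite -subr_ge0 xS invr_ge0 ltW.
  have hi1 := x01 _ (ltnW hi); have hi2 := x01 _ hi.
  have [|//|z zi fz] := @IVT _ f (x i) (x i.+1) 0 lex.
  - apply: (@lipschitz_within_continuous _ _ _ _ K) => u v.
    rewrite /= !in_itv/= => /andP[u1 u2] /andP[v1 v2].
    move: hi1 hi2; rewrite /I01/= => /andP[? ?] /andP[? ?].
    by apply: fK; rewrite /I01/=; lra.
  - by rewrite ge_min le_max; move: sgn; do 2 case: ltrP => //= ?; lra.
  - by exists z => //; move: zi; rewrite in_itv.
(* A sign change on this edge yields a zero [z] of [F1] on it, where [F2 < 0]. At the grid point
   [F1] is small, so |F2| exceeds [d / 2] by the gap; being within [d / 2] of a negative value, [F2]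
   is negative there and the edge does not count. *)
have top i : (i < n)%N -> hh i n = 0.
  move=> hi; rewrite /hh /om; have [->|Sne] := eqVneq (S i.+1 n) (S i n).
    by rewrite subrr mul0r.
  suff -> : Q i n = false by rewrite mulr0.
  have [||z /andP[z1 z2] Fz] := zero (fun p => F1 p 1) i _ hi.
  - move=> p q hp hq; have o01 : I01 1 by rewrite /I01/= ler01 lexx.
    by have := F1K hp o01 hq o01; rewrite subrr normr0 addr0.
  - by move: Sne; rewrite /S xn eq_sym.
  have hin := ltnW hi.
  have zin : I01 z.
    have /andP[? ?] := x01 _ hin; have /andP[? ?] := x01 _ hi.
    by rewrite /I01/=; apply/andP; split; lra.
  have Q2 := topP zin Fz.
  have a1 := small F1 _ _ _ _ (osc _ F1K i n i.+1 n hin (leqnn _) hi (leqnn _)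
    (near2S _) (near2r _)).
  have {}a1 : `|F1 (x i) 1| < d / 2.
    by rewrite xn in a1; apply: a1; rewrite eq_sym; move: Sne; rewrite /S xn.
  have a3 : `|F2 (x i) 1 - F2 z 1| < d / 2.
    apply: le_lt_trans nK.
    have o01 : I01 1 by rewrite /I01/= ler01 lexx.
    apply: le_trans (F2K (x01 _ hin) o01 zin o01) _.
    rewrite subrr normr0 addr0.
    apply: le_trans (_ : `|K| * `|x i - z| <= _).
      by rewrite ler_wpM2r// ler_norm.
    rewrite ler_wpM2l// distrC ger0_norm ?subr_ge0//.
    by have := xS i; have := n0; rewrite -invr_gt0; lra.
  have := gap _ _ (x01 _ hin) (x01 _ (leqnn n)).
  rewrite /Q xn; case: ltrP => // Q1; rewrite (gtr0_norm Q1).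
  by move: a3; rewrite ltr_norml; lra.
(* By the same reasoning [F2 > 0] at every crossing on the left side, so each one counts in full and
   their sum telescopes. *)
have left j : (j < n)%N -> vv 0%N j = sg (S 0%N j.+1) - sg (S 0%N j).
  move=> hj; rewrite /vv /om; have [->|Sne] := eqVneq (S 0%N j.+1) (S 0%N j).
    by rewrite subrr mul0r.
  suff -> : Q 0%N j = true by rewrite mulr1.
  have [||z /andP[z1 z2] Fz] := zero (fun q => F1 0 q) j _ hj.
  - move=> p q hp hq; have o01 : I01 0 by rewrite /I01/= ler01 lexx.
    by have := F1K o01 hp o01 hq; rewrite subrr normr0 add0r.
  - by move: Sne; rewrite /S x0 eq_sym.
  have hjn := ltnW hj.
  have zin : I01 z.
    have /andP[? ?] := x01 _ hjn; have /andP[? ?] := x01 _ hj.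
    by rewrite /I01/=; apply/andP; split; lra.
  have Q2 := leftP zin Fz.
  have a1 := small F1 _ _ _ _ (osc _ F1K 0%N j 0%N j.+1 isT hjn isT hj
    (near2r _) (near2S _)).
  have {}a1 : `|F1 0 (x j)| < d / 2.
    by rewrite x0 in a1; apply: a1; rewrite eq_sym; move: Sne; rewrite /S x0.
  have o01 : I01 0 by rewrite /I01/= ler01 lexx.
  have a3 : `|F2 0 (x j) - F2 0 z| < d / 2.
    apply: le_lt_trans nK.
    apply: le_trans (F2K o01 (x01 _ hjn) o01 zin) _.
    rewrite subrr normr0 add0r.
    apply: le_trans (_ : `|K| * `|x j - z| <= _).
      by rewrite ler_wpM2r// ler_norm.
    rewrite ler_wpM2l// distrC ger0_norm ?subr_ge0//.
    by have := xS j; have := n0; rewrite -invr_gt0; lra.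
  have := gap _ _ o01 (x01 _ hjn).
  rewrite /Q x0; case: ltrP => // Q1; rewrite (ler0_norm Q1).
  by move: a3; rewrite ltr_norml; lra.
have tel (f : nat -> int) : \sum_(0 <= k < n) (f k.+1 - f k) = f n - f 0%N.
  exact: telescope_sumr.
(* A discrete Green formula: interior edges cancel, so the sum of the cell counts, which is 0,
   reduces to the four sides, which give -1. *)
have tot : \sum_(0 <= i < n) \sum_(0 <= j < n)
    ((hh i j - hh i j.+1) + (vv i.+1 j - vv i j)) = 0.
  rewrite big_nat big1// => i /andP[_ hi].
  by rewrite big_nat big1// => j /andP[_ hj]; exact: cell0.
have : \sum_(0 <= i < n) \sum_(0 <= j < n) (hh i j - hh i j.+1) = 0.
  rewrite big_nat big1// => i /andP[_ hi].
  rewrite (eq_bigr (fun j => - (hh i j.+1 - hh i j))); last first.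
    by move=> j _; rewrite opprB.
  by rewrite sumrN tel bot// top// subrr oppr0.
have : \sum_(0 <= i < n) \sum_(0 <= j < n) (vv i.+1 j - vv i j) = -1.
  rewrite exchange_big/=.
  rewrite (eq_bigr (fun j => vv n j - vv 0%N j)); last by move=> j _; exact: tel.
  rewrite big_nat.
  rewrite (eq_bigr (fun j => - (sg (S 0%N j.+1) - sg (S 0%N j)))); last first.
    by move=> j /andP[_ hj]; rewrite right// left// sub0r.
  rewrite -big_nat sumrN tel /S x0 xn left1.
  by rewrite (ltNge 0 (F1 0 0)) left0 /sg.
move: tot; under eq_bigr do rewrite big_split/=.
by rewrite big_split/= => + h1 h2; rewrite h1 h2.
Qed.
End planar.

(** * Integrals over half-open intervals *)

Section int_oc.
Variable R : realType.
Local Notation mu := (@lebesgue_measure R).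
Implicit Types (f g : R -> R) (x y : R).

(** Half-open intervals concatenate without overlap. For [y <= x] the value is 0, not the opposite
    of the integral from [y] to [x]. *)
Definition int_oc f x y : R := \int[mu]_(t in `]x, y]) f t.

Local Notation L1 f := (mu.-integrable setT (EFin \o f)).

Let L1S f x y : L1 f -> mu.-integrable `]x, y] (EFin \o f).
Proof. exact: integrableS. Qed.

Lemma int_ocD f x m y : L1 f -> x <= m -> m <= y ->
  int_oc f x y = int_oc f x m + int_oc f m y.
Proof.
move=> fL xm my; rewrite /int_oc.
rewrite -(@Rintegral_itvB _ _ (BRight x) (BRight y) m) ?bnd_simp//.
  by rewrite addrC subrK.
exact: L1S.
Qed.

Lemma le_int_oc f g x y : L1 f -> L1 g ->
  (forall t, x < t <= y -> f t <= g t) -> int_oc f x y <= int_oc g x y.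
Proof.
move=> fL gL fg; apply: le_Rintegral; [by []|exact: L1S|exact: L1S|].
by move=> t; rewrite /= in_itv; exact: fg.
Qed.

Lemma int_oc_ge0 f x y : (forall t, x < t <= y -> 0 <= f t) -> 0 <= int_oc f x y.
Proof. by move=> f0; apply: Rintegral_ge0 => t /=; rewrite in_itv; exact: f0. Qed.

Lemma norm_int_oc f x y : L1 f ->
  `|int_oc f x y| <= int_oc (fun t => `|f t|) x y.
Proof. by move=> fL; apply: le_normr_Rintegral => //; exact: L1S. Qed.

Lemma int_ocB f g x y : L1 f -> L1 g ->
  int_oc (fun t => f t - g t) x y = int_oc f x y - int_oc g x y.
Proof. by move=> fL gL; apply: RintegralB => //; exact: L1S. Qed.

Lemma int_ocZ f c x y : L1 f ->
  int_oc (fun t => c * f t) x y = c * int_oc f x y.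
Proof. by move=> fL; apply: RintegralZl => //; exact: L1S. Qed.

Lemma eq_int_oc f g x y : (forall t, x < t <= y -> f t = g t) ->
  int_oc f x y = int_oc g x y.
Proof. by move=> fg; apply: eq_Rintegral => t; rewrite inE/= in_itv; exact: fg. Qed.

Lemma L1_norm f : L1 f -> L1 (fun t => `|f t|).
Proof. exact: integrable_norm. Qed.

Lemma int_oc_sub f x y x' y' : L1 f -> (forall t, 0 <= f t) ->
  x' <= x -> x <= y -> y <= y' -> int_oc f x y <= int_oc f x' y'.
Proof.
move=> fL f0 xx xy yy; rewrite (@int_ocD f x' x y')//; last exact: le_trans yy.
rewrite (@int_ocD f x y y')//.
have := @int_oc_ge0 f x' x (fun t _ => f0 t).
by have := @int_oc_ge0 f y y' (fun t _ => f0 t); lra.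
Qed.

Lemma int_oc_ge f x y : y <= x -> int_oc f x y = 0.
Proof.
by move=> yx; rewrite /int_oc set_itv_ge ?bnd_simp -?leNgt// Rintegral_set0.
Qed.

Lemma int_oc_cont f e : L1 f -> 0 < e -> exists2 d, 0 < d &
  forall x y, y - x < d -> int_oc (fun t => `|f t|) x y < e.
Proof.
move=> fL e0; have [d [d0 fd]] := integral_normr_continuous fL e0.
exists d => // x y xyd; have [xy|yx] := ltrP x y; last by rewrite int_oc_ge.
apply: fd => //; rewrite [X in (X < _)%E](_ : _ = (y - x)%:E) ?lte_fin//.
by have := @lebesgue_measure_itv R `]x, y]; rewrite /= lte_fin xy -EFinD.
Qed.

End int_oc.

(** * Exponential weights adapted to an integrable coefficient *)

Section weight.
Variable R : realType.
Local Notation mu := (@lebesgue_measure R).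
Variables (b : R -> R) (T : R).
Hypothesis bL : mu.-integrable setT (EFin \o b).
Hypothesis T0 : 0 < T.
Hypothesis b0 : forall t, ~~ (0 < t <= T) -> b t = 0.
Local Notation L1 f := (mu.-integrable setT (EFin \o f)).

(** As [b] vanishes outside []0, T]], [h] may be composed with the clamp to [[0, T]], which makes it
    bounded. *)
Lemma L1_mulc (h : R -> R) : continuous h -> L1 (fun t => b t * h t).
Proof.
move=> ch; pose k t := h (Num.min (Num.max t 0) T).
have ck : continuous k.
  move=> t; apply: continuous_comp; last exact: ch.
  apply: (@lipschitz_continuous _ _ 1) => u v; rewrite mul1r.
  exact: lipschitz_clamp.
have [M kM] : exists M, forall t, `|k t| <= M.
  have [||c _ hc] := @EVT_max _ (fun t => `|h t|) 0 T; first exact: ltW.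
    apply: continuous_subspaceT => t.
    by apply: continuous_comp; [exact: ch|exact: norm_continuous].
  exists `|h c| => t; apply: hc.
  rewrite in_itv/= le_min le_max lexx orbT (ltW T0)/=.
  by rewrite ge_min lexx orbT.
have -> : (EFin \o (fun t => b t * h t)) = ((EFin \o b) \* (EFin \o k))%E.
  apply/funext => t /=; rewrite -EFinM; congr EFin.
  have [t01|tn] := boolP (0 < t <= T); last by rewrite b0// !mul0r.
  have /andP[t0 tT] := t01.
  by rewrite /k (max_idPl (ltW t0)) (min_idPl tT).
apply: integrableMl => //.
  exact: measurable_realfun.continuous_measurable_fun.
exists M; split; first exact: num_real.
by move=> z Mz t _; apply: (le_trans (kM t)); rewrite ltW.
Qed.

(** For nonnegative [k] the product |b| k is |b k|; and [h] is the difference of the nonnegative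
    functions |h| and |h| - h. *)
Lemma L1_normc (h : R -> R) : continuous h -> L1 (fun t => `|b t| * h t).
Proof.
move=> ch.
have nb : continuous (fun t => `|h t|).
  by move=> t; apply: continuous_comp; [exact: ch|exact: norm_continuous].
have H (k : R -> R) : continuous k -> (forall t, 0 <= k t) ->
    L1 (fun t => `|b t| * k t).
  move=> ck k0; have := L1_norm (L1_mulc ck).
  congr (_.-integrable _ _); apply/funext => t /=.
  by rewrite normrM (ger0_norm (k0 t)).
have h1 : continuous (fun t => `|h t| - h t).
  by move=> t; apply: cvgB; [exact: nb|exact: ch].
have I1 := H _ nb (fun t => normr_ge0 _).
have I2 := H _ h1 (fun t => etrans (subr_ge0 _ _) (ler_norm _)).
have := integrableB measurableT I1 I2.
congr (_.-integrable _ _); apply/funext => t /=.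
by rewrite -EFinB; congr EFin; ring.
Qed.

Definition mass : R := \int[mu]_(t in setT) `|b t|.

Lemma mass_ge0 : 0 <= mass.
Proof. by apply: Rintegral_ge0. Qed.

Lemma int_oc_mass x y : int_oc (fun t => `|b t|) x y <= mass.
Proof.
have nL := L1_norm bL.
rewrite /mass /int_oc /Rintegral fine_le//.
- apply: integrable_fin_num => //; exact: integrableS nL.
- exact: integrable_fin_num.
- apply: ge0_subset_integral => //; by case/integrableP : nL.
Qed.

Lemma int_oc_weight_le (h : R -> R) (c x y : R) : continuous h -> 0 <= c ->
  (forall t, x < t <= y -> h t <= c) ->
  int_oc (fun t => `|b t| * h t) x y <= c * int_oc (fun t => `|b t|) x y.
Proof.
move=> ch c0 hc; rewrite -int_ocZ; last exact: L1_norm.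
apply: le_int_oc; first exact: L1_normc.
  have -> : (fun t => c * `|b t|) = (fun t => `|b t| * cst c t).
    by apply/funext => t; rewrite mulrC.
  exact/L1_normc/cst_continuous.
by move=> t /hc htc; rewrite mulrC ler_wpM2r.
Qed.

(* An exponential weight with a steep slope is negligible outside a window of
   length [d / 2], and inside the window the mass of [b] is small. *)
Lemma weight_ex K : 0 <= K -> exists2 l, 0 <= l &
  (forall x y, x <= y ->
    K * int_oc (fun t => `|b t| * expR (l * (t - x))) x y
      <= expR (l * (y - x)) / 2) /\
  (forall x y, x <= y ->
    K * int_oc (fun t => `|b t| * expR (l * (y - t))) x y
      <= expR (l * (y - x)) / 2).
Proof.
(* With [K * e <= 1 / 4], the window and its complement each contribute at most a quarter of the
   weight. *)
move=> K0; pose e : R := (4 * (K + 1))^-1.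
have K4 : 0 < 4 * (K + 1) by lra.
have e0 : 0 < e by rewrite invr_gt0.
have Ke : K * e <= 1 / 4.
  by rewrite /e ler_pdivrMr//; lra.
have [d d0 hd] := int_oc_cont bL e0.
(* From [expR z >= 1 + z] one gets [expR (- z) * mass <= e]; the slope [l] makes the weight drop by
   the factor [expR (- z)] over the length [d / 2]. *)
pose z := 4 * (K + 1) * mass.
have z0 : 0 <= z by rewrite mulr_ge0 ?mass_ge0// ltW.
have ze : expR (- z) * mass <= e.
  rewrite expRN ler_pdivrMl ?expR_gt0// /e ler_pdivlMr//.
  by have := expR_ge1Dx z; rewrite /z; lra.
pose l := 2 * z / d.
have l0 : 0 <= l by rewrite divr_ge0 ?(ltW d0)// mulr_ge0.
have ld s : l * (s - d / 2) = l * s - z by rewrite /l; field; rewrite gt_eqF.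
have cE c0 c1 : continuous (fun t : R => expR (l * (c0 * t + c1))).
  move=> t; apply: continuous_comp; last exact: continuous_expR.
  apply: (@lipschitz_continuous _ _ `|l * c0|) => u v.
  rewrite -normrM (_ : _ - _ = l * c0 * (u - v))//; ring.
have c1 x : continuous (fun t : R => expR (l * (t - x))).
  have -> : (fun t : R => expR (l * (t - x))) =
      (fun t => expR (l * (1 * t + - x))).
    by apply/funext => t; rewrite mul1r.
  exact: cE.
have c2 y : continuous (fun t : R => expR (l * (y - t))).
  have -> : (fun t : R => expR (l * (y - t))) =
      (fun t => expR (l * (-1 * t + y))).
    by apply/funext => t; rewrite mulN1r addrC.
  exact: cE.
have mono s s' : s <= s' -> expR (l * s) <= expR (l * s').
  by move=> ss; rewrite ler_expR ler_wpM2l.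
exists l => //; split=> x y xy.
- have [yxd|yxd] := ltrP (y - x) d.
    have h1 : int_oc (fun t => `|b t| * expR (l * (t - x))) x y <=
        expR (l * (y - x)) * int_oc (fun t => `|b t|) x y.
      apply: int_oc_weight_le; [exact: c1|exact: expR_ge0|].
      by move=> t /andP[_ ty]; rewrite mono// lerD2r.
    have h2 := ltW (hd _ _ yxd).
    have h3 := expR_gt0 (l * (y - x)).
    apply: le_trans (ler_wpM2l K0 h1) _.
    apply: le_trans (_ : expR (l * (y - x)) * (K * e) <= _); last by nra.
    by rewrite mulrCA ler_wpM2l ?(ltW h3)// ler_wpM2l.
  pose m := y - d / 2.
  have xm : x <= m by rewrite /m; lra.
  have my : m <= y by rewrite /m; lra.
  rewrite (@int_ocD _ _ x m y)//; last exact: L1_normc.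
  have h1 : int_oc (fun t => `|b t| * expR (l * (t - x))) x m <=
      expR (l * (m - x)) * int_oc (fun t => `|b t|) x m.
    apply: int_oc_weight_le; [exact: c1|exact: expR_ge0|].
    by move=> t /andP[_ ty]; rewrite mono// lerD2r.
  have h2 : int_oc (fun t => `|b t| * expR (l * (t - x))) m y <=
      expR (l * (y - x)) * int_oc (fun t => `|b t|) m y.
    apply: int_oc_weight_le; [exact: c1|exact: expR_ge0|].
    by move=> t /andP[_ ty]; rewrite mono// lerD2r.
  have h3 : int_oc (fun t => `|b t|) m y <= e.
    by apply/ltW/hd; rewrite /m; lra.
  have h4 : expR (l * (m - x)) * int_oc (fun t => `|b t|) x m <=
      expR (l * (y - x)) * e.
    rewrite (_ : m - x = (y - x) - d / 2); last by rewrite /m; lra.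
    rewrite ld expRD -mulrA ler_wpM2l ?expR_ge0//; apply: le_trans ze.
    by rewrite ler_wpM2l ?expR_ge0 ?int_oc_mass.
  have h5 := expR_gt0 (l * (y - x)).
  have h6 := ler_wpM2l (ltW h5) h3.
  apply: le_trans (_ : K * (2 * (expR (l * (y - x)) * e)) <= _).
    by rewrite ler_wpM2l//; lra.
  by have := ler_wpM2l (ltW h5) Ke; lra.
- have [yxd|yxd] := ltrP (y - x) d.
    have h1 : int_oc (fun t => `|b t| * expR (l * (y - t))) x y <=
        expR (l * (y - x)) * int_oc (fun t => `|b t|) x y.
      apply: int_oc_weight_le; [exact: c2|exact: expR_ge0|].
      by move=> t /andP[/ltW ty _]; rewrite mono// lerD2l lerN2.
    have h2 := ltW (hd _ _ yxd).
    have h3 := expR_gt0 (l * (y - x)).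
    apply: le_trans (ler_wpM2l K0 h1) _.
    apply: le_trans (_ : expR (l * (y - x)) * (K * e) <= _); last by nra.
    by rewrite mulrCA ler_wpM2l ?(ltW h3)// ler_wpM2l.
  pose m := x + d / 2.
  have xm : x <= m by rewrite /m; lra.
  have my : m <= y by rewrite /m; lra.
  rewrite (@int_ocD _ _ x m y)//; last exact: L1_normc.
  have h1 : int_oc (fun t => `|b t| * expR (l * (y - t))) m y <=
      expR (l * (y - m)) * int_oc (fun t => `|b t|) m y.
    apply: int_oc_weight_le; [exact: c2|exact: expR_ge0|].
    by move=> t /andP[/ltW ty _]; rewrite mono// lerD2l lerN2.
  have h2 : int_oc (fun t => `|b t| * expR (l * (y - t))) x m <=
      expR (l * (y - x)) * int_oc (fun t => `|b t|) x m.
    apply: int_oc_weight_le; [exact: c2|exact: expR_ge0|].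
    by move=> t /andP[/ltW ty _]; rewrite mono// lerD2l lerN2.
  have h3 : int_oc (fun t => `|b t|) x m <= e.
    by apply/ltW/hd; rewrite /m; lra.
  have h4 : expR (l * (y - m)) * int_oc (fun t => `|b t|) m y <=
      expR (l * (y - x)) * e.
    rewrite (_ : y - m = (y - x) - d / 2); last by rewrite /m; lra.
    rewrite ld expRD -mulrA ler_wpM2l ?expR_ge0//; apply: le_trans ze.
    by rewrite ler_wpM2l ?expR_ge0 ?int_oc_mass.
  have h5 := expR_gt0 (l * (y - x)).
  have h6 := ler_wpM2l (ltW h5) h3.
  apply: le_trans (_ : K * (2 * (expR (l * (y - x)) * e)) <= _).
    by rewrite ler_wpM2l//; lra.
  by have := ler_wpM2l (ltW h5) Ke; lra.
Qed.
End weight.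

(** * The Caratheodory initial value problem *)

(** The intervals of centre [a n] and radius [2 * C / 2 ^+ n] are nested, and the supremum of their
    left ends lies in all of them. *)
Lemma geometric_limit (R : realType) (a : nat -> R) (C : R) :
  (forall n, `|a n.+1 - a n| <= C / 2 ^+ n) ->
  exists l, forall n, `|l - a n| <= 2 * C / 2 ^+ n.
Proof.
move=> aC; pose lo n := a n - 2 * C / 2 ^+ n; pose hi n := a n + 2 * C / 2 ^+ n.
have half n : 2 * C / 2 ^+ n.+1 = C / 2 ^+ n.
  by rewrite exprS; field; rewrite expf_neq0.
have loS n : lo n <= lo n.+1.
  by rewrite /lo half; have := aC n; rewrite ler_norml; lra.
have hiS n : hi n.+1 <= hi n.
  by rewrite /hi half; have := aC n; rewrite ler_norml; lra.
have C0 n : 0 <= C / 2 ^+ n by exact: le_trans (aC n).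
have lohi n m : lo n <= hi m.
  apply: (@le_trans _ _ (lo (maxn n m))).
    by apply: (homo_leq (lexx) le_trans loS); rewrite leq_maxl.
  apply: (@le_trans _ _ (hi (maxn n m))).
    by rewrite /lo /hi; have := C0 (maxn n m); lra.
  apply: (homo_leq (lexx) (fun y x z h1 h2 => le_trans h2 h1) hiS).
  by rewrite leq_maxr.
have sup_lo : has_sup (range lo).
  by split; [exists (lo 0%N); exists 0%N|exists (hi 0%N) => _ [n _ <-]].
exists (sup (range lo)) => n.
have h1 : lo n <= sup (range lo).
  by apply: sup_upper_bound => //; exists n.
have h2 : sup (range lo) <= hi n.
  by apply: ge_sup => [|_ [m _ <-]]; first by case: sup_lo.
by rewrite ler_norml; move: h1 h2; rewrite /lo /hi; lra.
Qed.

Lemma le_of_geometric (R : realType) (x C : R) :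
  (forall n, x <= C / 2 ^+ n) -> x <= 0.
Proof.
move=> xC; rewrite leNgt; apply/negP => x0.
have C0 : 0 < C by have := xC 0%N; rewrite expr0 divr1; lra.
pose n := (Num.truncn (C / x)).+1.
have : C / x < n%:R by exact: truncnS_gt.
have : n%:R < 2 ^+ n :> R by rewrite -natrX ltr_nat ltn_expl.
have := xC n; rewrite ler_pdivlMr ?exprn_gt0// => h1 h2 h3.
have : C / x < 2 ^+ n by exact: lt_trans h2.
by rewrite ltr_pdivrMr//; lra.
Qed.

Section ode.
Variable R : realType.
Local Notation mu := (@lebesgue_measure R).
Variables (w : R -> R) (T : R).
Hypothesis wL : mu.-integrable setT (EFin \o w).
Hypothesis T0 : 0 < T.
Hypothesis w0 : forall t, ~~ (0 < t <= T) -> w t = 0.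
Variables (G : R -> R) (L : R).
Hypothesis L0 : 0 <= L.
Hypothesis GL : forall x y, `|G x - G y| <= L * `|x - y|.
Local Notation L1 f := (mu.-integrable setT (EFin \o f)).

Lemma nonlinearity_continuous : continuous G.
Proof. exact: lipschitz_continuous GL. Qed.

Lemma continuous_Gcomp (h : R -> R) : continuous h -> continuous (G \o h).
Proof.
by move=> ch t; apply: continuous_comp; [exact: ch|exact: nonlinearity_continuous].
Qed.

Lemma L1_force (h : R -> R) : continuous h -> L1 (fun t => w t * G (h t)).
Proof. by move=> ch; apply: (L1_mulc wL T0 w0 (continuous_Gcomp ch)). Qed.

(** At a point [c] where |z| / W attains its maximum [m], the integral inequality reads
    [m * W c <= C + m * W c / 2]; hence [m <= 2 * C], because [W c >= 1]. The bounds [lo] and [hi]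
    allow integration from the left end or towards the right end of the interval. *)
Lemma gronwall (p q : R) (lo hi W z : R -> R) (C K : R) :
  0 <= K -> continuous W -> continuous z -> (forall x, 0 < W x) ->
  (forall x, p <= x <= q -> 1 <= W x) ->
  (forall x, p <= x <= q -> p <= lo x /\ hi x <= q) ->
  (forall x, p <= x <= q ->
     K * int_oc (fun t => `|w t| * W t) (lo x) (hi x) <= W x / 2) ->
  (forall x, p <= x <= q ->
     `|z x| <= C + K * int_oc (fun t => `|w t| * `|z t|) (lo x) (hi x)) ->
  forall x, p <= x <= q -> `|z x| <= 2 * C * W x.
Proof.
move=> K0 cW cz Wgt0 W1 lohi wW wz x pxq.
have pq : p <= q by case/andP: pxq; exact: le_trans.
have cnz : continuous (fun t => `|z t|).
  by move=> t; apply: continuous_comp; [exact: cz|exact: norm_continuous].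
have cf : {within `[p, q], continuous (fun t => `|z t| / W t)}.
  apply: continuous_subspaceT => t; apply: cvgM; first exact: cnz.
  by apply: cvgV; [rewrite gt_eqF|exact: cW].
have [c] := EVT_max pq cf; rewrite in_itv/= => cpq cmax.
set m := `|z c| / W c in cmax.
have m0 : 0 <= m by rewrite divr_ge0// ltW.
have zm t : p <= t <= q -> `|z t| <= m * W t.
  by move=> tpq; rewrite -ler_pdivrMr//; apply: cmax; rewrite in_itv.
have zcm : `|z c| = m * W c by rewrite /m divfK// gt_eqF.
have [plo hiq] := lohi _ cpq.
have h1 : int_oc (fun t => `|w t| * `|z t|) (lo c) (hi c) <=
    m * int_oc (fun t => `|w t| * W t) (lo c) (hi c).
  rewrite -int_ocZ; last exact: (L1_normc wL T0 w0).
  apply: le_int_oc; first exact: (L1_normc wL T0 w0).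
    have -> : (fun t => m * (`|w t| * W t)) = (fun t => `|w t| * (m * W t)).
      by apply/funext => t; rewrite mulrCA.
    apply: (L1_normc wL T0 w0) => t.
    by apply: cvgM; [exact: cvg_cst|exact: cW].
  move=> t /andP[t1 t2]; rewrite mulrCA ler_wpM2l// zm//.
  by rewrite (le_trans plo (ltW t1)) (le_trans t2 hiq).
have h2 := wz _ cpq.
have h3 := wW _ cpq.
have h4 := ler_wpM2l K0 h1.
have h5 := ler_wpM2l m0 h3.
have mC : m * W c <= 2 * C by lra.
have m2C : m <= 2 * C.
  by apply: le_trans mC; rewrite ler_peMr// W1.
by apply: (le_trans (zm _ pxq)); rewrite ler_wpM2r// ltW.
Qed.

(* [u'' + w G(u) = 0] on [p, q] in integrated form, with [v] standing for [u']. *)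
Definition ivp_sol (p q : R) (u v : R -> R) : Prop :=
  [/\ continuous u,
      forall x, p <= x <= q -> is_derive x 1 u (v x) &
      forall x y, p <= x -> x <= y -> y <= q ->
        v y - v x = - int_oc (fun t => w t * G (u t)) x y].

Lemma sol_sub p q p' q' u v : p <= p' -> q' <= q -> ivp_sol p q u v ->
  ivp_sol p' q' u v.
Proof.
move=> pp qq [cu du dv]; split => //.
- by move=> x /andP[px xq]; apply: du; rewrite (le_trans pp)//= (le_trans _ qq).
- move=> x y p'x xy yq'; apply: dv => //; [exact: le_trans pp _|exact: le_trans qq].
Qed.

Lemma mean_value_sol p q u v x y : ivp_sol p q u v ->
  p <= x -> x <= y -> y <= q ->
  exists2 c, x <= c <= y & u y - u x = v c * (y - x).
Proof.
move=> [cu du _] px xy yq.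
have [|//|c] := @MVT_segment _ u v x y xy; last first.
- by rewrite in_itv/= => xcy ->; exists c.
- exact: continuous_subspaceT.
- move=> c; rewrite in_itv/= => /andP[xc cy]; apply: du.
  by rewrite (le_trans px (ltW xc)) (le_trans (ltW cy) yq).
Qed.

Lemma velocity_dist p q u1 v1 u2 v2 x y :
  ivp_sol p q u1 v1 -> ivp_sol p q u2 v2 -> p <= x -> x <= y -> y <= q ->
  `|(v1 y - v2 y) - (v1 x - v2 x)| <=
    L * int_oc (fun t => `|w t| * `|u1 t - u2 t|) x y.
Proof.
move=> [cu1 _ d1] [cu2 _ d2] px xy yq.
have cz : continuous (fun t => `|u1 t - u2 t|).
  move=> t; apply: (@continuous_comp _ _ _ (fun t => u1 t - u2 t)).
    by apply: cvgB; [exact: cu1|exact: cu2].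
  exact: norm_continuous.
rewrite (_ : _ - _ = (v1 y - v1 x) - (v2 y - v2 x)); last by ring.
rewrite d1// d2// opprK addrC -int_ocB; [|exact: L1_force..].
apply: le_trans (norm_int_oc _ _ _) _.
  exact: (integrableB measurableT (L1_force cu2) (L1_force cu1)).
rewrite -int_ocZ; last exact: (L1_normc wL T0 w0).
apply: le_int_oc.
- apply: L1_norm.
  exact: (integrableB measurableT (L1_force cu2) (L1_force cu1)).
- have -> : (fun t => L * (`|w t| * `|u1 t - u2 t|)) =
      (fun t => `|w t| * (L * `|u1 t - u2 t|)).
    by apply/funext => t; rewrite mulrCA.
  apply: (L1_normc wL T0 w0) => t.
  by apply: cvgM; [exact: cvg_cst|exact: cz].
- move=> t _; rewrite -mulrBr normrM mulrCA ler_wpM2l//.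
  by rewrite distrC.
Qed.

(** The constant serves all subintervals and all solutions, so comparisons may start at any time. By
    the mean value theorem the difference [z] of two solutions grows at most by [T] times a bound on
    the velocity difference, itself an integral of |w| |z|: [gronwall] applies with coefficient
    [T * L], forwards and backwards. *)
Lemma sol_stable : exists2 E : R, 0 < E & forall (p q : R) u1 v1 u2 v2,
  0 <= p -> q <= T -> ivp_sol p q u1 v1 -> ivp_sol p q u2 v2 ->
  (forall x, p <= x <= q -> `|u1 x - u2 x| + `|v1 x - v2 x| <=
     E * (`|u1 p - u2 p| + `|v1 p - v2 p|)) /\
  (forall x, p <= x <= q -> `|u1 x - u2 x| + `|v1 x - v2 x| <=
     E * (`|u1 q - u2 q| + `|v1 q - v2 q|)).
Proof.
have TL0 : 0 <= T * L by rewrite mulr_ge0// ltW.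
have [l l0 [lf lb]] := weight_ex wL T0 w0 TL0.
pose e := expR (l * T).
have e1 : 1 <= e by rewrite -expR0 ler_expR mulr_ge0 ?(ltW T0).
(* This is the bound [2 * C * W] of [gronwall] with [C = (1 + T) * S] and [W <= e]; the velocity
   contributes [1 + L * mass w * E] more. *)
pose E := 2 * (1 + T) * e.
have E0 : 0 < E by rewrite !mulr_gt0 ?expR_gt0// addr_gt0.
have m0 := mass_ge0 w.
exists (E + (1 + L * mass w * E)).
  have h := mulr_ge0 (mulr_ge0 L0 m0) (ltW E0); lra.
move=> p q u1 v1 u2 v2 p0 qT s1 s2.
have [cu1 du1 _] := s1; have [cu2 du2 _] := s2.
pose z t := u1 t - u2 t; pose y t := v1 t - v2 t.
have cz : continuous z by move=> t; apply: cvgB; [exact: cu1|exact: cu2].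
have sz x x' : p <= x -> x <= x' -> x' <= q ->
    exists2 c, x <= c <= x' & z x' - z x = y c * (x' - x).
  move=> px xx' x'q.
  have [c|//|c] := @MVT_segment _ z y x x' xx'; last first.
  - by rewrite in_itv/= => xcy ->; exists c.
  - exact: continuous_subspaceT.
  - rewrite in_itv/= => /andP[xc cx'].
    have pcq : p <= c <= q.
      by rewrite (le_trans px (ltW xc)) (le_trans (ltW cx') x'q).
    by apply: is_deriveB; [exact: du1|exact: du2].
have dy := velocity_dist s1 s2.
have cnz : continuous (fun t => `|z t|).
  by move=> t; apply: continuous_comp; [exact: cz|exact: norm_continuous].
have wzL := L1_normc wL T0 w0 cnz.
have wz0 t : 0 <= `|w t| * `|z t| by rewrite mulr_ge0.
have cW (k : R -> R) c : (forall x x', `|k x - k x'| <= c * `|x - x'|) ->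
    continuous (fun t => expR (l * k t)).
  move=> kc t; apply: (@continuous_comp _ _ _ (fun t => l * k t)).
    apply: (@lipschitz_continuous _ _ (l * c)) => x x'.
    by rewrite -mulrBr normrM (ger0_norm l0) -mulrA ler_wpM2l.
  exact: continuous_expR.
have eT s : 0 <= s -> 1 <= expR (l * s).
  by move=> s0; rewrite -expR0 ler_expR mulr_ge0.
have leT s : s <= T -> expR (l * s) <= e.
  by move=> sT; rewrite ler_expR ler_wpM2l.
split=> x pxq.
- set S := `|u1 p - u2 p| + `|v1 p - v2 p|; have S0 : 0 <= S by rewrite addr_ge0.
  have zx t : p <= t <= q -> `|z t| <= E * S.
    move=> tpq; pose C := (1 + T) * S.
    have C0 : 0 <= C by rewrite mulr_ge0//; lra.
    apply: (@le_trans _ _ (2 * C * expR (l * (t - p)))); last first.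
      rewrite (_ : E * S = 2 * C * e); last by rewrite /E /C; ring.
      by rewrite ler_wpM2l ?leT ?mulr_ge0//; case/andP: tpq; lra.
    apply: (@gronwall p q (fun=> p) id (fun t => expR (l * (t - p))) z C (T * L))
      => //.
    + apply: (cW (fun t => t - p) 1) => a a'.
      by rewrite mul1r (_ : a - p - (a' - p) = a - a')//; ring.
    + by move=> a; exact: expR_gt0.
    + by move=> a /andP[pa _]; apply: eT; lra.
    + by move=> a /andP[].
    + by move=> a /andP[pa aq]; exact: lf.
    + move=> a /andP[pa aq]; have [c /andP[pc ca] zc] := sz _ _ (lexx p) pa aq.
      have h1 := dy _ _ (lexx p) pc (le_trans ca aq); rewrite -/(y c) -/(y p) in h1.
      have h2 : int_oc (fun t => `|w t| * `|z t|) p c <=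
          int_oc (fun t => `|w t| * `|z t|) p a by exact: int_oc_sub.
      have h3 : `|y c| <= `|y p| + L * int_oc (fun t => `|w t| * `|z t|) p a.
        have h4 : `|y c| <= `|y p| + `|y c - y p|.
          by rewrite -{1}(subrK (y p) (y c)) addrC ler_normD.
        by have := ler_wpM2l L0 h2; lra.
      have -> : z a = z p + y c * (a - p) by rewrite -zc addrC subrK.
      apply: le_trans (ler_normD _ _) _; rewrite normrM.
      have ap0 : 0 <= a - p by lra.
      have apT : a - p <= T by lra.
      rewrite (ger0_norm ap0).
      have h5 := ler_wpM2l (normr_ge0 (y c)) apT.
      have h6 := ler_wpM2r (ltW T0) h3.
      rewrite /C /S -/(z p) -/(y p).
      have z1 := mulr_ge0 (ltW T0) (normr_ge0 (z p)).
      by have := normr_ge0 (y p); lra.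
  have yx : `|y x| <= S + L * mass w * E * S.
    have /andP[px xq] := pxq.
    have h1 := dy _ _ (lexx p) px xq; rewrite -/(y x) -/(y p) in h1.
    have h2 : int_oc (fun t => `|w t| * `|z t|) p x <= (E * S) * mass w.
      apply: (@le_trans _ _ (E * S * int_oc (fun t => `|w t|) p x)).
        apply: (int_oc_weight_le wL T0 w0) => //.
          by rewrite mulr_ge0// ltW.
        by move=> t /andP[pt tx]; apply: zx; rewrite (ltW pt) (le_trans tx xq).
      by rewrite ler_wpM2l ?int_oc_mass// mulr_ge0// ltW.
    have h4 : `|y x| <= `|y p| + `|y x - y p|.
      by rewrite -{1}(subrK (y p) (y x)) addrC ler_normD.
    have h5 : `|y p| <= S by rewrite lerDr.
    apply: le_trans h4 _.
    apply: le_trans (lerD h5 (le_trans h1 (ler_wpM2l L0 h2))) _.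
    by rewrite (_ : L * (E * S * mass w) = L * mass w * E * S)//; ring.
  by apply: le_trans (lerD (zx x pxq) yx) _; rewrite !mulrDl mul1r.
- set S := `|u1 q - u2 q| + `|v1 q - v2 q|; have S0 : 0 <= S by rewrite addr_ge0.
  have zx t : p <= t <= q -> `|z t| <= E * S.
    move=> tpq; pose C := (1 + T) * S.
    have C0 : 0 <= C by rewrite mulr_ge0//; lra.
    apply: (@le_trans _ _ (2 * C * expR (l * (q - t)))); last first.
      rewrite (_ : E * S = 2 * C * e); last by rewrite /E /C; ring.
      by rewrite ler_wpM2l ?leT ?mulr_ge0//; case/andP: tpq; lra.
    apply: (@gronwall p q id (fun=> q) (fun t => expR (l * (q - t))) z C (T * L))
      => //.
    + apply: (cW (fun t => q - t) 1) => a a'.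
      by rewrite mul1r (_ : q - a - (q - a') = a' - a) 1?distrC//; ring.
    + by move=> a; exact: expR_gt0.
    + by move=> a /andP[_ aq]; apply: eT; lra.
    + by move=> a /andP[].
    + by move=> a /andP[pa aq]; exact: lb.
    + move=> a /andP[pa aq]; have [c /andP[ac cq] zc] := sz _ _ pa aq (lexx q).
      have h1 := dy _ _ (le_trans pa ac) cq (lexx q).
      rewrite -/(y c) -/(y q) in h1.
      have h2 : int_oc (fun t => `|w t| * `|z t|) c q <=
          int_oc (fun t => `|w t| * `|z t|) a q by exact: int_oc_sub.
      have h3 : `|y c| <= `|y q| + L * int_oc (fun t => `|w t| * `|z t|) a q.
        have h4 : `|y c| <= `|y q| + `|y q - y c|.
          by have := ler_normB (y q) (y q - y c); rewrite subKr.
        by have := ler_wpM2l L0 h2; lra.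
      have -> : z a = z q - y c * (q - a) by rewrite -zc; ring.
      apply: le_trans (ler_normB _ _) _; rewrite normrM.
      have ap0 : 0 <= q - a by lra.
      have apT : q - a <= T by lra.
      rewrite (ger0_norm ap0).
      have h5 := ler_wpM2l (normr_ge0 (y c)) apT.
      have h6 := ler_wpM2r (ltW T0) h3.
      rewrite /C /S -/(z q) -/(y q).
      have z1 := mulr_ge0 (ltW T0) (normr_ge0 (z q)).
      by have := normr_ge0 (y q); lra.
  have yx : `|y x| <= S + L * mass w * E * S.
    have /andP[px xq] := pxq.
    have h1 := dy _ _ px xq (lexx q); rewrite -/(y x) -/(y q) in h1.
    have h2 : int_oc (fun t => `|w t| * `|z t|) x q <= (E * S) * mass w.
      apply: (@le_trans _ _ (E * S * int_oc (fun t => `|w t|) x q)).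
        apply: (int_oc_weight_le wL T0 w0) => //.
          by rewrite mulr_ge0// ltW.
        by move=> t /andP[xt tq]; apply: zx; rewrite (le_trans px (ltW xt)) tq.
      by rewrite ler_wpM2l ?int_oc_mass// mulr_ge0// ltW.
    have h4 : `|y x| <= `|y q| + `|y q - y x|.
      by have := ler_normB (y q) (y q - y x); rewrite subKr.
    have h5 : `|y q| <= S by rewrite lerDr.
    apply: le_trans h4 _.
    apply: le_trans (lerD h5 (le_trans h1 (ler_wpM2l L0 h2))) _.
    by rewrite (_ : L * (E * S * mass w) = L * mass w * E * S)//; ring.
  by apply: le_trans (lerD (zx x pxq) yx) _; rewrite !mulrDl mul1r.
Qed.

End ode.

(** * Existence by Picard iteration *)

Section existence.
Variable R : realType.
Local Notation mu := (@lebesgue_measure R).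
Variables (w : R -> R) (T : R).
Hypothesis wL : mu.-integrable setT (EFin \o w).
Hypothesis T0 : 0 < T.
Hypothesis w0 : forall t, ~~ (0 < t <= T) -> w t = 0.
Variables (G : R -> R) (L : R).
Hypothesis L0 : 0 <= L.
Hypothesis GL : forall x y, `|G x - G y| <= L * `|x - y|.
Local Notation L1 f := (mu.-integrable setT (EFin \o f)).

(** Because [f] vanishes for [t <= 0], the default value 0 of [int_oc f 0 x] at negative [x] is the
    right one. So the primitive is defined on the whole line, and derivatives at the endpoints of
    [[0, T]] can be two-sided. *)
Lemma int_oc_primitive (f : R -> R) x y : L1 f ->
  (forall t, ~~ (0 < t <= T) -> f t = 0) -> x <= y ->
  int_oc f 0 y - int_oc f 0 x = int_oc f x y.
Proof.
move=> fL f0 xy.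
have zero s : s <= 0 -> int_oc f x s = 0.
  move=> s0; rewrite (@eq_int_oc _ _ (fun t => 0 * f t)) ?int_ocZ ?mul0r// => t.
  by move=> /andP[_ ts]; rewrite mul0r f0// negb_and -leNgt (le_trans ts s0).
have [x0|x0] := lerP 0 x; first by rewrite (int_ocD fL x0 xy) addrC addKr.
rewrite (@int_oc_ge _ f 0 x (ltW x0)) subr0.
have [y0|y0] := lerP y 0; first by rewrite int_oc_ge// zero.
by rewrite (int_ocD fL (ltW x0) (ltW y0)) zero// add0r.
Qed.

Lemma int_oc_kernel (f : R -> R) y d a b : L1 f -> L1 (fun t => t * f t) ->
  0 <= d -> (forall t, a < t <= b -> `|y - t| <= d) ->
  `|y * int_oc f a b - int_oc (fun t => t * f t) a b| <=
    d * int_oc (fun t => `|f t|) a b.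
Proof.
move=> fL f1L d0 yd.
have yfL : L1 (fun t => y * f t) by exact: (integrableZl measurableT y fL).
have kL : L1 (fun t => y * f t - t * f t).
  exact: (integrableB measurableT yfL f1L).
rewrite -int_ocZ// -int_ocB//; apply: le_trans (norm_int_oc _ _ kL) _.
rewrite -int_ocZ; last exact: L1_norm.
apply: le_int_oc; first exact: L1_norm.
  exact: (integrableZl measurableT d (L1_norm fL)).
by move=> t tab; rewrite -mulrBl normrM ler_wpM2r ?yd.
Qed.

(** The function is the twofold primitive of [f]. Its increment from [x] to [y] minus the linear
    part is the integral of [(y - t) * f t], at most |y - x| times an integral of |f| over a short
    interval. So it is differentiable everywhere although [f] is only integrable. *)
Lemma is_derive_second_primitive (f : R -> R) (x : R) : L1 f ->
  L1 (fun t => t * f t) -> (forall t, ~~ (0 < t <= T) -> f t = 0) ->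
  is_derive x 1 (fun x : R => x * int_oc f 0 x - int_oc (fun t => t * f t) 0 x)
    (int_oc f 0 x).
Proof.
move=> fL f1L f0; have f10 t : ~~ (0 < t <= T) -> t * f t = 0.
  by move=> /f0 ->; rewrite mulr0.
apply: is_derive_eps => e e0; have [d d0 fd] := int_oc_cont fL e0.
exists d => // y; have [xy|yx] := lerP x y => yxd.
- have h1 := int_oc_primitive fL f0 xy; have h2 := int_oc_primitive f1L f10 xy.
  have yx0 : 0 <= y - x by rewrite subr_ge0.
  have h3 : forall t, x < t <= y -> `|y - t| <= y - x.
    by move=> t /andP[xt ty]; rewrite ger0_norm; lra.
  have := int_oc_kernel fL f1L yx0 h3; rewrite -h1 -h2 => h4.
  have h5 := fd _ _ yxd; have h6 := ler_wpM2l yx0 (ltW h5).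
  rewrite [leRHS]mulrC; apply: le_trans h6; apply: le_trans h4.
  by rewrite le_eqVlt; apply/orP; left; apply/eqP; congr (`| _ |); ring.
- have h1 := int_oc_primitive fL f0 (ltW yx).
  have h2 := int_oc_primitive f1L f10 (ltW yx).
  have yx0 : 0 <= x - y by rewrite subr_ge0 ltW.
  have h3 : forall t, y < t <= x -> `|y - t| <= x - y.
    by move=> t /andP[xt ty]; rewrite ler0_norm; lra.
  have := int_oc_kernel fL f1L yx0 h3; rewrite -h1 -h2 => h4.
  have h5 := fd _ _ yxd; have h6 := ler_wpM2l yx0 (ltW h5).
  rewrite [leRHS]mulrC; apply: le_trans h6; apply: le_trans h4.
  by rewrite -normrN le_eqVlt; apply/orP; left; apply/eqP; congr (`| _ |); ring.
Qed.

Let force (h : R -> R) (t : R) : R := w t * G (h t).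

Let force0 h t : ~~ (0 < t <= T) -> force h t = 0.
Proof. by move=> /w0; rewrite /force => ->; rewrite mul0r. Qed.

Let force1L (h : R -> R) : continuous h -> L1 (fun t => t * force h t).
Proof.
move=> ch; have -> : (fun t => t * force h t) = (fun t => w t * (t * G (h t))).
  by apply/funext => t; rewrite mulrCA.
apply: (L1_mulc wL T0 w0) => t.
by apply: cvgM; [exact: cvg_id|exact: (continuous_Gcomp GL ch)].
Qed.

Section picard.
Variables s y : R.

(* The term in parentheses is the integral of [(x - t) * force h t] over
   [0 < t <= x]. *)
Definition picard (h : R -> R) (x : R) : R :=
  s + y * x - (x * int_oc (force h) 0 x - int_oc (fun t => t * force h t) 0 x).

Lemma is_derive_picard (h : R -> R) (x : R) : continuous h ->
  is_derive x 1 (picard h) (y - int_oc (force h) 0 x).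
Proof.
move=> ch; have fL := L1_force wL T0 w0 GL ch.
have h1 := is_derive_second_primitive x fL (force1L ch) (@force0 h).
apply: is_deriveB.
apply: is_derive_eps => e e0; exists 1 => // z _.
by rewrite (_ : _ - _ - _ = 0) ?normr0 ?mulr_ge0// ?ltW//; ring.
Qed.

Lemma continuous_picard (h : R -> R) : continuous h -> continuous (picard h).
Proof.
move=> ch x; apply/differentiable_continuous/derivable1_diffP.
by have [] := is_derive_picard x ch.
Qed.

Lemma picard_contract (h1 h2 : R -> R) (x : R) :
  continuous h1 -> continuous h2 -> 0 <= x <= T ->
  `|picard h1 x - picard h2 x| <=
    T * L * int_oc (fun t => `|w t| * `|h1 t - h2 t|) 0 x.
Proof.
move=> c1 c2 /andP[x0 xT].
have f1L := L1_force wL T0 w0 GL c1; have f2L := L1_force wL T0 w0 GL c2.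
pose f t := force h2 t - force h1 t.
have fL : L1 f by exact: (integrableB measurableT f2L f1L).
have ftE : (fun t => t * f t) = (fun t => t * force h2 t - t * force h1 t).
  by apply/funext => t; rewrite mulrBr.
have ftL : L1 (fun t => t * f t).
  rewrite ftE.
  exact: (integrableB measurableT (force1L c2) (force1L c1)).
have xt t : 0 < t <= x -> `|x - t| <= T.
  by move=> /andP[t0 tx]; rewrite ger0_norm; lra.
have := int_oc_kernel fL ftL (ltW T0) xt.
rewrite ftE (int_ocB _ _ (force1L c2) (force1L c1)) {1}/f int_ocB// => h.
rewrite (_ : picard h1 x - picard h2 x =
  x * (int_oc (force h2) 0 x - int_oc (force h1) 0 x) -
  (int_oc (fun t => t * force h2 t) 0 x -
   int_oc (fun t => t * force h1 t) 0 x)); last by rewrite /picard; ring.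
apply: le_trans h _; rewrite -mulrA ler_wpM2l ?(ltW T0)//.
have cz : continuous (fun t => `|h1 t - h2 t|).
  move=> t; apply: (@continuous_comp _ _ _ (fun t => h1 t - h2 t)).
    by apply: cvgB; [exact: c1|exact: c2].
  exact: norm_continuous.
rewrite -int_ocZ; last exact: (L1_normc wL T0 w0).
apply: le_int_oc.
- exact: L1_norm fL.
- exact: (integrableZl measurableT L (L1_normc wL T0 w0 cz)).
- move=> t _; rewrite /f/force -mulrBr normrM mulrCA ler_wpM2l//.
  by rewrite (distrC (h1 t)).
Qed.

Let h_ n := iter n picard (cst s).

Let ch_ n : continuous (h_ n).
Proof. by elim: n => [|n IH]; [exact: cst_continuous|exact: continuous_picard]. Qed.

Let h_S n x : h_ n.+1 x = picard (h_ n) x. Proof. by []. Qed.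

(** In the norm weighted by [expR (l * x)] the Picard map halves distances on all of [[0, T]] at
    once. *)
Lemma picard_geometric : exists2 C, 0 <= C & forall n x, 0 <= x <= T ->
  `|h_ n.+1 x - h_ n x| <= C / 2 ^+ n.
Proof.
have TL0 : 0 <= T * L by rewrite mulr_ge0// ltW.
have [l l0 [lf _]] := weight_ex wL T0 w0 TL0.
have cn n : continuous (fun t => `|h_ n.+1 t - h_ n t|).
  move=> t; apply: (@continuous_comp _ _ _ (fun t => h_ n.+1 t - h_ n t)).
    by apply: cvgB; exact: ch_.
  exact: norm_continuous.
have [m m01 mmax] := EVT_max (ltW T0) (continuous_subspaceT (cn 0%N)).
pose M := `|h_ 1%N m - h_ 0%N m|; have Mge0 : 0 <= M := normr_ge0 _.
have cE : continuous (fun t : R => expR (l * (t - 0))).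
  move=> t; apply: (@continuous_comp _ _ _ (fun t => l * (t - 0))).
    apply: (@lipschitz_continuous _ _ l) => a a'.
    by rewrite -mulrBr normrM (ger0_norm l0) !subr0.
  exact: continuous_expR.
have H n x : 0 <= x <= T ->
    `|h_ n.+1 x - h_ n x| <= M / 2 ^+ n * expR (l * (x - 0)).
  elim: n x => [|n IH] x x01.
    apply: (@le_trans _ _ M); first by apply: mmax; rewrite in_itv.
    have x0 : 0 <= l * (x - 0) by rewrite subr0 mulr_ge0//; case/andP: x01.
    have e1 : 1 <= expR (l * (x - 0)) by rewrite -expR0 ler_expR.
    by rewrite expr0 divr1 ler_peMr// normr_ge0.
  have /andP[x0 xT] := x01.
  rewrite !h_S; apply: le_trans (picard_contract (@ch_ n.+1) (@ch_ n) x01) _.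
  have h1 : int_oc (fun t => `|w t| * `|h_ n.+1 t - h_ n t|) 0 x <=
      M / 2 ^+ n * int_oc (fun t => `|w t| * expR (l * (t - 0))) 0 x.
    rewrite -int_ocZ; last exact: (L1_normc wL T0 w0).
    apply: le_int_oc.
    - exact: (L1_normc wL T0 w0).
    - exact: (integrableZl measurableT _ (L1_normc wL T0 w0 cE)).
    - move=> t /andP[t0 tx]; rewrite mulrCA ler_wpM2l// IH//.
      by rewrite (ltW t0) (le_trans tx xT).
  apply: le_trans (ler_wpM2l TL0 h1) _.
  rewrite mulrCA.
  have M0 : 0 <= M / 2 ^+ n by apply: divr_ge0 => //; exact: exprn_ge0.
  apply: le_trans (ler_wpM2l M0 (lf _ _ x0)) _.
  rewrite exprS invfM le_eqVlt; apply/orP; left; apply/eqP; ring.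
exists (M * expR (l * T)); first by apply: mulr_ge0 => //; exact: expR_ge0.
move=> n x x01; apply: le_trans (H n x x01) _.
rewrite mulrAC ler_wpM2r ?invr_ge0 ?exprn_ge0// ler_wpM2l// ler_expR ler_wpM2l//.
by case/andP: x01; lra.
Qed.

Lemma sol_exists : exists u v, [/\ ivp_sol w G 0 T u v, u 0 = s & v 0 = y].
Proof.
have [C C0 hC] := picard_geometric.
pose clamp x : R := Num.min (Num.max x 0) T.
have c01 x : 0 <= clamp x <= T.
  by rewrite /clamp le_min le_max lexx orbT (ltW T0) ge_min lexx orbT.
have cid x : 0 <= x <= T -> clamp x = x.
  by move=> /andP[x0 xT]; rewrite /clamp (max_idPl x0) (min_idPl xT).
have /choice[h hl] x : exists l, forall n, `|l - h_ n (clamp x)| <= 2 * C / 2 ^+ n.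
  by apply: geometric_limit => n; apply: hC.
have cc n : continuous (fun x => h_ n (clamp x)).
  move=> x; apply: (@continuous_comp _ _ _ clamp); last exact: ch_.
  apply: (@lipschitz_continuous _ _ 1) => u v; rewrite mul1r.
  exact: lipschitz_clamp.
have ch : continuous h.
  move=> x; apply/cvgrPdist_lt => e e0.
  have [n hn] : exists n, 2 * C / 2 ^+ n < e / 3.
    apply: contrapT => /forallNP hn.
    have : e / 3 <= 0.
      by apply: (@le_of_geometric _ _ (2 * C)) => n; rewrite leNgt; apply/negP/hn.
    by lra.
  near=> z.
  have h1 := le_lt_trans (hl x n) hn; have h2 := le_lt_trans (hl z n) hn.
  have h3 : `|h_ n (clamp x) - h_ n (clamp z)| < e / 3.
    near: z; have /cvgrPdist_lt := cc n x; apply; lra.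
  rewrite (_ : h x - h z = (h x - h_ n (clamp x)) +
    (h_ n (clamp x) - h_ n (clamp z)) + (h_ n (clamp z) - h z)); last by ring.
  rewrite (le_lt_trans (ler_normD _ _))//.
  rewrite distrC in h2.
  have := ler_normD (h x - h_ n (clamp x)) (h_ n (clamp x) - h_ n (clamp z)).
  by lra.
have fix_h x : 0 <= x <= T -> picard h x = h x.
  move=> x01; apply/eqP; rewrite -subr_eq0 -normr_le0.
  pose D := T * L * mass w * (2 * C) + 2 * C.
  apply: (@le_of_geometric _ _ D) => n.
  have h1 := hl x n.+1; rewrite (cid x x01) h_S in h1.
  have h2 := picard_contract ch (@ch_ n) x01.
  have /andP[x0 xT] := x01.
  have n0 : 0 <= 2 * C / 2 ^+ n by rewrite divr_ge0 ?mulr_ge0 ?exprn_ge0.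
  have h3 : int_oc (fun t => `|w t| * `|h t - h_ n t|) 0 x <=
      2 * C / 2 ^+ n * mass w.
    apply: (@le_trans _ _ (2 * C / 2 ^+ n * int_oc (fun t => `|w t|) 0 x)).
      apply: (int_oc_weight_le wL T0 w0) => //.
        move=> t; apply: (@continuous_comp _ _ _ (fun t => h t - h_ n t)).
          by apply: cvgB; [exact: ch|exact: ch_].
        exact: norm_continuous.
      move=> t /andP[t0 tx].
      have t01 : 0 <= t <= T by rewrite (ltW t0) (le_trans tx).
      by have := hl t n; rewrite cid.
    by rewrite ler_wpM2l ?int_oc_mass.
  have TL0 : 0 <= T * L by rewrite mulr_ge0// ltW.
  have h4 := le_trans h2 (ler_wpM2l TL0 h3).
  have h5 : 2 * C / 2 ^+ n.+1 <= 2 * C / 2 ^+ n.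
    rewrite ler_wpM2l ?mulr_ge0// lef_pV2 ?posrE ?exprn_gt0//.
    by rewrite exprS ler_peMl ?exprn_ge0// ler1n.
  rewrite (_ : picard h x - h x = (picard h x - picard (h_ n) x) -
     (h x - picard (h_ n) x)); last by ring.
  apply: le_trans (ler_normB _ _) _; apply: le_trans (lerD h4 (le_trans h1 h5)) _.
  by rewrite /D le_eqVlt; apply/orP; left; apply/eqP; ring.
(* The witness is [picard h], which agrees with [h] on [[0, T]]: the clamped limit [h] is constant
   outside and need not have two-sided derivatives at 0 and [T]. *)
exists (picard h), (fun x => y - int_oc (force h) 0 x); split.
- split; first exact: continuous_picard.
    by move=> x _; exact: is_derive_picard.
  move=> a b _ ab _.
  have fL := L1_force wL T0 w0 GL ch.
  rewrite (_ : _ - _ = - (int_oc (force h) 0 b - int_oc (force h) 0 a));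
    last by ring.
  rewrite (int_oc_primitive fL (@force0 h) ab); congr (- _).
  apply: eq_int_oc => t _.
  have [t01|tn] := boolP (0 < t <= T); last by rewrite /force w0// !mul0r.
  by rewrite /force fix_h//; move: t01 => /andP[/ltW -> ->].
- by rewrite /picard !int_oc_ge// !mulr0 !subr0 addr0.
- by rewrite int_oc_ge// subr0.
Unshelve. all: by end_near. Qed.

End picard.
End existence.

(** * Qualitative behaviour of solutions *)

Lemma is_derive_epsP (R : realType) (f : R -> R) (x l : R) :
  is_derive x 1 f l ->
  forall e, 0 < e -> exists2 d, 0 < d & forall y, `|y - x| < d ->
     `|f y - f x - l * (y - x)| <= e * `|y - x|.
Proof.
move=> [df dfl] e e0.
have cv : h^-1 *: (f (h *: 1 + x) - f x) @[h --> 0^'] --> l.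
  by rewrite -dfl; exact: df.
move/cvgrPdist_le : cv => /(_ _ e0) [d /= d0 hd].
exists d => // y yxd; have [->|yx] := eqVneq y x.
  by rewrite !subrr mulr0 subrr normr0 mulr0.
have yx0 : y - x != 0 by rewrite subr_eq0.
have := hd (y - x); rewrite /= sub0r normrN => /(_ yxd yx0).
rewrite [_ *: 1]mulr1 subrK -[_ *: _]/(_ * _) => h.
rewrite -(ler_pM2r (_ : 0 < `|y - x|)) ?normr_gt0// in h.
apply: le_trans h; rewrite -normrM -normrN.
rewrite le_eqVlt; apply/orP; left; apply/eqP; congr (`| _ |).
by field.
Qed.

Lemma continuous_eps (R : realType) (f : R -> R) (x : R) :
  {for x, continuous f} ->
  forall e, 0 < e -> exists2 d, 0 < d & forall y, `|y - x| < d ->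
    `|f y - f x| < e.
Proof.
move=> /cvgrPdist_lt cf e e0; have [d /= d0 hd] := cf e e0.
by exists d => // y yxd; rewrite distrC; apply: hd; rewrite /= distrC.
Qed.

Section shooting_estimates.
Variable R : realType.
Local Notation mu := (@lebesgue_measure R).
Variables (w : R -> R) (T : R).
Hypothesis wL : mu.-integrable setT (EFin \o w).
Hypothesis T0 : 0 < T.
Hypothesis w0 : forall t, ~~ (0 < t <= T) -> w t = 0.
Variables (G : R -> R) (L : R).
Hypothesis L0 : 0 <= L.
Hypothesis GL : forall x y, `|G x - G y| <= L * `|x - y|.
Hypothesis G0 : forall s, s <= 0 -> G s = 0.
Hypothesis G_gt0 : forall s, 0 < s -> 0 < G s.
Local Notation L1 f := (mu.-integrable setT (EFin \o f)).
Local Notation sol := (ivp_sol w G).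

Lemma nonlinearity_ge0 s : 0 <= G s.
Proof. by have [/G0 ->//|/G_gt0/ltW] := lerP s 0. Qed.

(** These explicit solutions are what [sol_stable] is compared with: a nonpositive line gives
    uniqueness after a zero, and the zero solution bounds a solution by its data. *)
Lemma sol_affine p q (c k : R) : (forall x, p <= x <= q -> k * (x - c) <= 0) ->
  sol p q (fun x => k * (x - c)) (cst k).
Proof.
move=> neg; split.
- apply: (@lipschitz_continuous _ _ `|k|) => x y.
  by rewrite -mulrBr normrM (_ : x - c - (y - c) = x - y)//; ring.
- move=> x _; apply: is_derive_eps => e e0; exists 1 => // y _.
  by rewrite (_ : _ - _ - _ = 0) ?normr0 ?mulr_ge0// ?ltW//; rewrite /cst; ring.
- move=> x y px xy yq; rewrite subrr.
  rewrite (@eq_int_oc _ _ (fun t => 0 * w t)).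
    by rewrite int_ocZ// mul0r oppr0.
  move=> t /andP[xt ty]; rewrite G0 ?mulr0 ?mul0r// neg//.
  by rewrite (le_trans px (ltW xt)) (le_trans ty yq).
Qed.

Lemma sol_zero p q : sol p q (fun x => 0 * (x - 0)) (cst 0).
Proof. by apply: sol_affine => x _; rewrite mul0r. Qed.

Lemma int_oc_force_le (h : R -> R) c a b : continuous h -> 0 <= c ->
  (forall t, a < t <= b -> `|h t| <= c) ->
  `|int_oc (fun t => w t * h t) a b| <= c * mass w.
Proof.
move=> ch c0 hc.
have cnh : continuous (fun t => `|h t|).
  by move=> t; apply: continuous_comp; [exact: ch|exact: norm_continuous].
apply: le_trans (norm_int_oc _ _ (L1_mulc wL T0 w0 ch)) _.
rewrite (@eq_int_oc _ _ (fun t => `|w t| * `|h t|)); last first.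
  by move=> t _; rewrite normrM.
apply: le_trans (int_oc_weight_le wL T0 w0 cnh c0 hc) _.
by rewrite ler_wpM2l ?int_oc_mass.
Qed.

(* [G] vanishes on the nonpositive reals, so after its first zero [u] follows a
   line; the slope is not 0 by uniqueness for the initial value problem. *)
Lemma hit_nonpos u v x : sol 0 T u v -> 0 <= u 0 -> 0 < u 0 \/ 0 < v 0 ->
  0 < x <= T -> u x <= 0 -> u T <= 0 /\ v T < 0.
Proof.
move=> suv u0 uv0 /andP[x0 xT] ux; have [cu du dv] := suv.
have [E E0 stab] := sol_stable wL T0 w0 L0 GL.
(* Even if [u 0 = 0], [u] is positive just after 0, so the first later zero, found as an infimum, is
   positive. *)
have [d d0 ud] : exists2 d, 0 < d & forall t, 0 < t < d -> 0 < u t.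
  have [u00|v00] := uv0.
    have [d d0 hd] := continuous_eps (cu 0) u00.
    exists d => // t /andP[t0 td].
    have := hd t; rewrite subr0 gtr0_norm// => /(_ td).
    by rewrite ltr_norml; lra.
  have v2 : 0 < v 0 / 2 by lra.
  have d0T : 0 <= (0 : R) <= T by rewrite lexx ltW.
  have [d d0 hd] := is_derive_epsP (du 0 d0T) v2.
  exists d => // t /andP[t0 td]; have := hd t; rewrite subr0 gtr0_norm// => /(_ td).
  by have := mulr_gt0 v2 t0; rewrite ler_norml; lra.
pose A := [set t | 0 < t <= T /\ u t <= 0].
have Ax : A x by split => //; rewrite x0 xT.
have Ad t : A t -> d <= t.
  move=> [/andP[t0 tT] ut]; rewrite leNgt; apply/negP => td.
  by have := ud t; rewrite t0 td => /(_ isT); rewrite ltNge ut.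
have infA : has_inf A by split; [exists x|exists d => t /Ad].
set x1 := inf A.
have dx1 : d <= x1 by apply: lb_le_inf => [|t /Ad//]; exists x.
have x1x : x1 <= x by apply: ge_inf => //; case: infA.
have x10 : 0 < x1 by lra.
have x1T : x1 <= T by lra.
have x1in : 0 <= x1 <= T by rewrite ltW.
have upos t : 0 < t < x1 -> 0 < u t.
  move=> /andP[t0 tx1]; rewrite ltNge; apply/negP => ut.
  have At : A t by split => //; rewrite t0 /=; lra.
  by have : x1 <= t; [apply: ge_inf => //; case: infA|lra].
have ux1le : u x1 <= 0.
  rewrite leNgt; apply/negP => ux1.
  have [e e0 he] := continuous_eps (cu x1) ux1.
  have [t At tx1] := inf_adherent e0 infA.
  have x1t : x1 <= t by apply: ge_inf => //; case: infA.
  have := he t; rewrite ger0_norm ?subr_ge0// ltrBlDl => /(_ tx1).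
  by case: At => _; rewrite ltr_norml; lra.
have ux1 : u x1 = 0.
  apply/eqP; rewrite eq_le ux1le /= leNgt; apply/negP => un.
  have un0 : 0 < - u x1 by lra.
  have [e e0 he] := continuous_eps (cu x1) un0.
  pose t := Num.max (x1 / 2) (x1 - e / 2).
  have tx1 : t < x1 by rewrite /t gt_max; apply/andP; split; lra.
  have t0 : 0 < t by rewrite /t lt_max; apply/orP; left; lra.
  have te : x1 - e / 2 <= t by rewrite /t le_max lexx orbT.
  have := upos t; rewrite t0 tx1 => /(_ isT).
  have := he t; rewrite distrC gtr0_norm ?subr_gt0// => /(_ _).
  have x1te : x1 - t < e by lra.
  by move=> /(_ x1te); rewrite ltr_norml; lra.
have vx1le : v x1 <= 0.
  rewrite leNgt; apply/negP => vp; have v2 : 0 < v x1 / 2 by lra.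
  have [e e0 he] := is_derive_epsP (du x1 x1in) v2.
  pose t := Num.max (x1 / 2) (x1 - e / 2).
  have tx1 : t < x1 by rewrite /t gt_max; apply/andP; split; lra.
  have t0 : 0 < t by rewrite /t lt_max; apply/orP; left; lra.
  have te : x1 - e / 2 <= t by rewrite /t le_max lexx orbT.
  have := upos t; rewrite t0 tx1 => /(_ isT) ut.
  have x1te : `|t - x1| < e by rewrite ltr0_norm; lra.
  have := he t x1te; rewrite (ltr0_norm (_ : t - x1 < 0)) ?subr_lt0//.
  have h := mulr_gt0 v2 (_ : 0 < x1 - t); rewrite subr_gt0 in h.
  by have := h tx1; rewrite ux1 ler_norml; lra.
have vx1 : v x1 < 0.
  rewrite lt_neqAle vx1le andbT; apply/eqP => vx1.
  have s1 := sol_sub (lexx 0) x1T suv.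
  have [_ st] := stab 0 x1 u v _ _ (lexx 0) x1T s1 (sol_zero 0 x1).
  have := st 0; rewrite lexx (ltW x10) => /(_ isT).
  rewrite ux1 vx1 /cst !mul0r !subr0 normr0 addr0 mulr0 => h.
  have := normr_ge0 (u 0); have := normr_ge0 (v 0).
  have := ler_norm (u 0); have := ler_norm (v 0).
  by case: uv0; lra.
have x1x1 : x1 <= x1 <= T by rewrite lexx.
have neg t : x1 <= t <= T -> v x1 * (t - x1) <= 0.
  by move=> /andP[x1t _]; rewrite mulr_le0_ge0 ?subr_ge0// ltW.
have s1 := sol_sub (ltW x10) (lexx T) suv.
have [st _] := stab x1 T u v _ _ (ltW x10) (lexx T) s1 (sol_affine neg).
have := st T; rewrite lexx x1T => /(_ isT).
rewrite ux1 /cst !(subrr, mulr0) normr0 addr0 mulr0.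
have := neg T; rewrite x1T lexx => /(_ isT).
set k := v x1 * _; have := ler_norm (u T - k); have := ler_norm (v T - v x1).
by have := normr_ge0 (u T - k); have := normr_ge0 (v T - v x1); lra.
Qed.

Section large.
Variables (p p' q' q c M : R).
Hypothesis p_ge0 : 0 <= p.
Hypothesis pp' : p < p'.
Hypothesis p'q' : p' < q'.
Hypothesis q'q : q' < q.
Hypothesis qT : q <= T.
Hypothesis w_ge0 : forall t, p < t <= q -> 0 <= w t.
Hypothesis c0 : 0 < c.
Hypothesis M0 : 0 < M.
Hypothesis GM : forall s, M <= s -> c * s <= G s.
(** The margin of [[p', q']] inside [[p, q]] controls slopes of positive concave functions; [k] is
    the resulting Harnack constant. In [strong], both sides are relative to [u p']: the left bounds
    the possible drop of slope over [[p', q']], the right the curvature forced by the growth of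
    [G]. *)
Let d := Num.min (p' - p) (q - q').
Let k := 1 + T / d.
Hypothesis strong : (1 + k) / d < c / k * int_oc w p' q'.

(* A solution which is positive on [p, q] is concave there, hence comparable to
   its maximum on [p', q'], where its total curvature would exceed what the
   slopes at [p'] and [q'] allow, unless the solution has moderate size. *)
Lemma large_hit : exists2 r, 0 < r & forall u v, sol 0 T u v -> 0 <= u 0 ->
  r <= `|u 0| + `|v 0| -> exists2 x, 0 < x <= T & u x <= 0.
Proof.
have [E E0 stab] := sol_stable wL T0 w0 L0 GL.
have d0 : 0 < d by rewrite /d lt_min !subr_gt0 pp'.
have k1 : 1 <= k by rewrite /k lerDl divr_ge0// ltW.
have k0 : 0 < k by exact: lt_le_trans k1.
(* If [u p' < k * M], then [K] bounds the state at [p'], and backward stability bounds the initial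
   data by [E * K]. Hence larger data give [u p' >= k * M], so that [u >= M] on [[p', q']]. *)
pose K := k * M + k * M / d.
have K0 : 0 <= K by rewrite addr_ge0// ?divr_ge0 ?mulr_ge0// ltW.
exists (E * K + 1); first by have := mulr_ge0 (ltW E0) K0; lra.
move=> u v suv u0 big; apply: contrapT => nohit.
have upos t : 0 < t <= T -> 0 < u t.
  by move=> t0; rewrite ltNge; apply/negP => ut; apply: nohit; exists t.
have unn t : 0 <= t <= T -> 0 <= u t.
  move=> /andP[]; rewrite le_eqVlt => /orP[/eqP <-//|t0 tT].
  by apply/ltW/upos; rewrite t0.
have [cu du dv] := suv.
have vmono x y : p <= x -> x <= y -> y <= q -> v y <= v x.
  move=> px xy yq; rewrite -subr_le0 dv//; [|exact: le_trans px|exact: le_trans qT].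
  rewrite oppr_le0; apply: int_oc_ge0 => t /andP[xt ty].
  rewrite mulr_ge0 ?nonlinearity_ge0// w_ge0//.
  by rewrite (le_lt_trans px xt) (le_trans ty yq).
have tangent x z : p <= x <= q -> p <= z <= q -> u z <= u x + v x * (z - x).
  move=> /andP[px xq] /andP[pz zq]; have [xz|zx] := lerP x z.
    have [a /andP[xa az] uE] :=
      mean_value_sol suv (le_trans p_ge0 px) xz (le_trans zq qT).
    have h := vmono _ _ px xa (le_trans az zq).
    have zx0 : 0 <= z - x by lra.
    by have := ler_wpM2r zx0 h; lra.
  have [a /andP[xa az] uE] :=
    mean_value_sol suv (le_trans p_ge0 pz) (ltW zx) (le_trans xq qT).
  have h := vmono _ _ (le_trans pz xa) az xq.
  have zx0 : 0 <= x - z by lra.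
  by have := ler_wpM2r zx0 h; lra.
have dp : d <= p' - p by rewrite /d ge_min lexx.
have dq : d <= q - q' by rewrite /d ge_min lexx orbT.
have sub x : p' <= x <= q' -> p <= x <= q.
  move=> /andP[h1 h2].
  by rewrite (le_trans (ltW pp') h1) (le_trans h2 (ltW q'q)).
have p'0 : 0 <= p' by exact: le_trans (ltW pp').
have q'T : q' <= T by exact: le_trans (ltW q'q) qT.
have pq : p <= q by exact: le_trans (ltW pp') (le_trans (ltW p'q') (ltW q'q)).
(* The tangent at [x] lies above [u], hence is nonnegative at [p] and at [q]; use the end towards
   which it descends. *)
have slope x : p' <= x <= q' -> d * `|v x| <= u x.
  move=> /andP[p'x xq'].
  have xpq := sub x (introT andP (conj p'x xq')).
  have pp : p <= p <= q by rewrite lexx.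
  have qq : p <= q <= q by rewrite lexx andbT.
  have h1 := tangent _ _ xpq pp; have h2 := tangent _ _ xpq qq.
  have h3 : 0 <= u p by apply: unn; rewrite p_ge0 (le_trans pq qT).
  have h4 : 0 <= u q by apply: unn; rewrite qT (le_trans p_ge0 pq).
  have [v0|v0] := ger0P (v x).
    have h : d <= x - p by rewrite (le_trans dp)// lerB.
    by have := ler_wpM2r v0 h; lra.
  have h : d <= q - x by rewrite (le_trans dq)// lerB.
  have v0' : 0 <= - v x by rewrite oppr_ge0 ltW.
  by have := ler_wpM2r v0' h; lra.
have harnack x z : p' <= x <= q' -> p' <= z <= q' -> u z <= k * u x.
  move=> xin zin; have h1 := slope _ xin.
  have h2 : `|v x| <= u x / d by rewrite ler_pdivlMr// mulrC.
  move: (xin) (zin) => /andP[px xq] /andP[pz zq].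
  have h3 : u z <= u x + v x * (z - x).
    by apply: tangent; apply: sub.
  have h4 : `|z - x| <= T.
    have [|] := lerP x z => _.
      by rewrite (le_trans _ q'T)// lerBlDr (le_trans zq)// lerDl (le_trans p'0).
    by rewrite (le_trans _ q'T)// lerBlDr (le_trans xq)// lerDl (le_trans p'0).
  have h5 : v x * (z - x) <= `|v x| * T.
    by rewrite (le_trans (ler_norm _))// normrM ler_wpM2l.
  have h6 := ler_wpM2r (ltW T0) h2.
  rewrite /k mulrDl mul1r mulrAC.
  by rewrite (_ : T * u x / d = u x / d * T); [lra|ring].
have p'in : p' <= p' <= q' by rewrite lexx ltW.
have q'in : p' <= q' <= q' by rewrite lexx ltW.
have m0 : 0 < u p'.
  by apply: upos; rewrite (le_lt_trans p_ge0 pp') (le_trans (ltW p'q') q'T).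
set m := u p' in m0.
have vp' : `|v p'| <= m / d by rewrite ler_pdivlMr// mulrC slope.
have [small|large] := ltrP m (k * M).
  have p'T : p' <= T by exact: le_trans (ltW p'q') q'T.
  have s1 := sol_sub (lexx 0) p'T suv.
  have [_ st] := stab 0 p' u v _ _ (lexx 0) p'T s1 (sol_zero 0 p').
  have := st 0; rewrite lexx p'0 => /(_ isT).
  rewrite /cst !mul0r !subr0 => h; have := le_trans big h; rewrite -/m.
  rewrite (gtr0_norm m0) => {}h.
  have h1 : m / d <= k * M / d by rewrite ler_wpM2r ?invr_ge0 ?ltW.
  have h2 : m + `|v p'| <= K.
    by apply: lerD; [exact: ltW|exact: le_trans vp' h1].
  have := le_trans h (ler_wpM2l (ltW E0) h2).
  by rewrite gerDl ler10.
have vq' : `|v q'| <= k * m / d.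
  rewrite ler_pdivlMr// mulrC; apply: le_trans (slope _ q'in) _.
  exact: harnack.
have dv' : v q' - v p' = - int_oc (fun t => w t * G (u t)) p' q'.
  by apply: dv => //; exact: ltW.
have low : c * (m / k) * int_oc w p' q' <=
    int_oc (fun t => w t * G (u t)) p' q'.
  rewrite -int_ocZ//; apply: le_int_oc.
  - exact: (integrableZl measurableT _ wL).
  - exact: (L1_force wL T0 w0 GL cu).
  - move=> t /andP[pt tq].
    have tin : p' <= t <= q' by rewrite ltW.
    have h1 : m / k <= u t by rewrite ler_pdivrMr// mulrC harnack.
    have h2 : M <= m / k by rewrite ler_pdivlMr// mulrC.
    rewrite mulrC ler_wpM2l//.
      by rewrite w_ge0// (lt_trans pp' pt) (le_trans tq (ltW q'q)).
    apply: le_trans (GM (le_trans h2 h1)).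
    by rewrite ler_wpM2l// ltW.
have h1 : int_oc (fun t => w t * G (u t)) p' q' <= m / d + k * m / d.
  rewrite -[leLHS]opprK -dv' opprB; apply: lerD.
    exact: le_trans (ler_norm _) vp'.
  by apply: le_trans (ler_norm _) _; rewrite normrN.
have := ltr_pM2l m0 ((1 + k) / d) (c / k * int_oc w p' q').
rewrite strong => /idP.
rewrite (_ : m * (c / k * int_oc w p' q') = c * (m / k) * int_oc w p' q');
  last by ring.
rewrite (_ : m * ((1 + k) / d) = m / d + k * m / d); last by ring.
by rewrite ltNge (le_trans low h1).
Qed.

End large.

Section small.
Hypothesis Gsmall : forall e, 0 < e -> exists2 r, 0 < r &
  forall s t, `|s| <= r -> `|t| <= r -> `|G s - G t| <= e * `|s - t|.
Hypothesis w_neg : int_oc w 0 T < 0.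

(* The first premise holds for both boundary conditions: it reads [0 <= _] when
   [v 0 = 0], and it is an equality when [u T = u 0]. It makes [u] constant up to
   an error [O(max G(u))], and then [v T - v 0] is close to
   [- G (u 0) * int w > 0]. *)
Lemma small_sign : exists2 r, 0 < r & forall u v, sol 0 T u v -> 0 <= u 0 ->
  0 < `|u 0| + `|v 0| <= r ->
  (`|v 0| * T <= `|u T - u 0 - v 0 * T| -> 0 < v T - v 0) /\
  (u 0 = 0 -> 0 < v 0 -> 0 < u T).
Proof.
have [E E0 stab] := sol_stable wL T0 w0 L0 GL.
set I := int_oc w 0 T; have I0 : I < 0 := w_neg; set B := mass w.
have B0 : 0 <= B := mass_ge0 w.
pose k := T * B; have k0 : 0 <= k by rewrite mulr_ge0// ltW.
(* [e] will be the Lipschitz constant of [G] on the range of [u]. The summands of [D] provide three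
   bounds: [ek] makes [G (u c) <= 2 * G (u 0)], [ekB] keeps the error below the main term
   [- I * G (u 0)], and [eBE] gives the sign of [u T] when [u 0 = 0]. *)
pose D := 4 * k + 1 + 4 * k * B / (- I) + B * E.
have kBI : 0 <= 4 * k * B / (- I).
  have h : 0 <= - I by rewrite oppr_ge0 ltW.
  have h4 : 0 <= 4 * k * B by rewrite mulr_ge0// mulr_ge0.
  exact: divr_ge0 h4 h.
have BE : 0 <= B * E by rewrite mulr_ge0// ltW.
have D0 : 0 < D by rewrite /D; lra.
pose e := D^-1; have e0 : 0 < e by rewrite invr_gt0.
have eD x : x < D -> e * x < 1.
  by move=> xD; rewrite /e ltr_pdivrMl ?mulr1.
have ek : e * (4 * k) < 1 by apply: eD; rewrite /D; lra.
have ekB : e * (4 * k * B) < - I.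
  have : e * (4 * k * B / (- I)) < 1 by apply: eD; rewrite /D; lra.
  by rewrite mulrA ltr_pdivrMr ?mul1r//; lra.
have eBE : e * (B * E) < 1 by apply: eD; rewrite /D; lra.
have [r r0 hr] := Gsmall e0.
exists (r / E); first by rewrite divr_gt0.
move=> u v suv u0 /andP[uv0 uvr]; have [cu du dv] := suv.
have usmall x : 0 <= x <= T -> `|u x| <= E * (`|u 0| + `|v 0|).
  move=> x01; have [st _] := stab 0 T u v _ _ (lexx 0) (lexx T) suv (sol_zero 0 T).
  have := st x x01; rewrite /cst !mul0r !subr0.
  by apply: le_trans; rewrite lerDl.
have ur x : 0 <= x <= T -> `|u x| <= r.
  move=> x01; apply: le_trans (usmall x x01) _.
  by rewrite mulrC -ler_pdivlMr.
have cGu : continuous (fun t => G (u t)) by exact: (continuous_Gcomp GL cu).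
have [c c01 cmax] := EVT_max (ltW T0) (continuous_subspaceT cGu).
rewrite in_itv/= in c01.
set m := G (u c) in cmax; have m0 : 0 <= m := nonlinearity_ge0 _.
have Gm t : 0 <= t <= T -> G (u t) <= m by move=> t01; apply: cmax; rewrite in_itv.
have vm x : 0 <= x <= T -> `|v x - v 0| <= m * B.
  move=> /andP[x0 xT]; rewrite (dv 0 x (lexx 0) x0 xT) normrN.
  apply: int_oc_force_le => // t /andP[t0 tx].
  by rewrite (ger0_norm (nonlinearity_ge0 _)) Gm// (ltW t0) (le_trans tx xT).
have um x : 0 <= x <= T -> `|u x - u 0 - v 0 * x| <= k * m.
  move=> /andP[x0 xT].
  have [a /andP[a0 ax] ->] := mean_value_sol suv (lexx 0) x0 xT.
  rewrite subr0 -mulrBl normrM (ger0_norm x0) /k -mulrA mulrC [B * m]mulrC.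
  by apply: ler_pM => //; apply: vm; rewrite a0 (le_trans ax xT).
split=> [vT|u00 v00].
  have TT : 0 <= T <= T by rewrite lexx ltW.
  have vkm : `|v 0| * T <= k * m by exact: le_trans vT (um _ TT).
  have du0 x : 0 <= x <= T -> `|u x - u 0| <= 2 * k * m.
    move=> x01; have /andP[x0 xT] := x01.
    rewrite -(subrK (v 0 * x) (u x - u 0)); apply: le_trans (ler_normD _ _) _.
    have h1 := um x x01.
    have h2 : `|v 0 * x| <= `|v 0| * T by rewrite normrM (ger0_norm x0) ler_wpM2l.
    by lra.
  have z01 : 0 <= (0 : R) <= T by rewrite lexx ltW.
  have Gu x : 0 <= x <= T -> `|G (u x) - G (u 0)| <= e * (2 * k * m).
    move=> x01; apply: le_trans (hr _ _ (ur _ x01) (ur _ z01)) _.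
    by apply: ler_wpM2l; [exact: ltW|exact: du0].
  (* [G (u c)] differs from [G (u 0)] by at most [e * (2 * k * m)], which is at most [m / 2]. *)
  have mG : m <= 2 * G (u 0).
    have := Gu c c01; rewrite -/m; have := ler_norm (m - G (u 0)).
    by have := ler_wpM2r m0 (ltW ek); lra.
  (* If [u 0 = 0], then [m = 0], so the premise forces [v 0 = 0] and the data would be trivial. *)
  have Gs : 0 < G (u 0).
    move: u0; rewrite le_eqVlt => /orP[/eqP u00|]; last exact: G_gt0.
    exfalso; move: mG; rewrite -u00 (G0 (lexx 0)) mulr0 => m00.
    have mE : m = 0 by apply/eqP; rewrite eq_le m00.
    move: vkm uv0; rewrite mE mulr0 -u00 normr0 add0r => h1 h2.
    by have := mulr_gt0 h2 T0; lra.
  have split_int : v T - v 0 = - (G (u 0) * I) -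
      int_oc (fun t => w t * (G (u t) - G (u 0))) 0 T.
    rewrite (dv 0 T (lexx 0) (ltW T0) (lexx T)) -opprD -int_ocZ//.
    have -> : (fun t => w t * (G (u t) - G (u 0))) =
        (fun t => w t * G (u t) - G (u 0) * w t).
      by apply/funext => t; rewrite mulrBr [G (u 0) * _]mulrC.
    rewrite int_ocB; [|exact: (L1_force wL T0 w0 GL cu)|
      exact: (integrableZl measurableT _ wL)].
    by rewrite addrC subrK.
  have cGG : continuous (fun t => G (u t) - G (u 0)).
    by move=> t; apply: cvgB; [exact: cGu|exact: cvg_cst].
  have e2 : 0 <= e * (2 * k * m) by rewrite !mulr_ge0// ltW.
  have h := @int_oc_force_le _ (e * (2 * k * m)) 0 T cGG e2 _.
  have {}h : `|int_oc (fun t => w t * (G (u t) - G (u 0))) 0 T| <=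
      e * (2 * k * m) * B.
    by apply: h => t /andP[t0 tT]; apply: Gu; rewrite ltW.
  have h1 : e * (2 * k * m) * B <= e * (4 * k * B) * G (u 0).
    have ekB0 : 0 <= e * (2 * k * B) by rewrite !mulr_ge0// ltW.
    by have := ler_wpM2l ekB0 mG; lra.
  have h2 : e * (4 * k * B) * G (u 0) < - I * G (u 0) by rewrite ltr_pM2r.
  rewrite split_int; set J := int_oc _ _ _ in h *.
  by have := ler_norm J; lra.
have TT : 0 <= T <= T by rewrite lexx ltW.
(* Here |u| is at most [E * v 0], so the deviation of [u T] from [v 0 * T], at most [k * m], is
   smaller than [v 0 * T]. *)
have mv : m <= e * (E * v 0).
  have := hr (u c) (u 0) (ur _ c01) (ur _ _).
  rewrite u00 (G0 (lexx 0)) !subr0 -/m (ger0_norm m0) => /(_ _)/le_trans; apply.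
    by rewrite lexx ltW.
  apply: ler_wpM2l; first exact: ltW.
  have := usmall c c01.
  by rewrite u00 normr0 add0r (gtr0_norm v00).
have := um T TT; rewrite u00 subr0.
have h1 := ler_wpM2l k0 mv.
have h2 : e * (B * E) * (v 0 * T) < v 0 * T by rewrite gtr_pMl// mulr_gt0.
have h3 : k * (e * (E * v 0)) = e * (B * E) * (v 0 * T) by rewrite /k; ring.
rewrite h3 in h1; rewrite ler_norml => /andP[h4 _]; lra.
Qed.
End small.
End shooting_estimates.

(** * Shooting *)

(* The unit square parametrizes the region [0 <= s, r <= s + |y| <= r + d] of
   initial data [(s, y)]. *)
Section diamond.
Variables (R : realType) (r d : R).
Hypothesis r0 : 0 < r.
Hypothesis d0 : 0 < d.

Definition radius (p : R) := r + d * p.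
Definition diamond_pos (p q : R) := radius p * (1 - `|2 * q - 1|).
Definition diamond_vel (p q : R) := radius p * (2 * q - 1).

Lemma radius_bounds p : 0 <= p <= 1 -> r <= radius p <= r + d.
Proof.
move=> /andP[p0 p1]; have := ler_wpM2l (ltW d0) p1.
by have := ler_wpM2l (ltW d0) p0; rewrite /radius; lra.
Qed.

Lemma radius_gt0 p : 0 <= p <= 1 -> 0 < radius p.
Proof. by move=> /radius_bounds /andP[h _]; exact: lt_le_trans h. Qed.

Lemma radius0 : radius 0 = r.
Proof. by rewrite /radius mulr0 addr0. Qed.

Lemma radius1 : radius 1 = r + d.
Proof. by rewrite /radius mulr1. Qed.

Let angle_le1 (q : R) : 0 <= q <= 1 -> `|2 * q - 1| <= 1.
Proof. by move=> /andP[q0 q1]; rewrite ler_norml; lra. Qed.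

Lemma diamond_pos_ge0 p q : 0 <= p <= 1 -> 0 <= q <= 1 -> 0 <= diamond_pos p q.
Proof.
by move=> /radius_gt0 h1 /angle_le1 h2; rewrite mulr_ge0 ?subr_ge0// ltW.
Qed.

Lemma diamond_norm p q : 0 <= p <= 1 -> 0 <= q <= 1 ->
  `|diamond_pos p q| + `|diamond_vel p q| = radius p.
Proof.
move=> hp hq; rewrite (ger0_norm (diamond_pos_ge0 hp hq)).
rewrite normrM (gtr0_norm (radius_gt0 hp)) /diamond_pos; ring.
Qed.

Lemma diamond_pos0 p : diamond_pos p 0 = 0.
Proof. by rewrite /diamond_pos mulr0 sub0r normrN normr1 subrr mulr0. Qed.

Lemma diamond_vel0 p : diamond_vel p 0 = - radius p.
Proof. by rewrite /diamond_vel mulr0 sub0r mulrN1. Qed.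

Lemma diamond_vel1 p : diamond_vel p 1 = radius p.
Proof. by rewrite /diamond_vel; ring. Qed.

Lemma diamond_pos1 p : diamond_pos p 1 = 0.
Proof.
have e : 2 * 1 - 1 = 1 :> R by ring.
by rewrite /diamond_pos e normr1 subrr mulr0.
Qed.

Let product_dist (p p' e e' : R) : 0 <= p' <= 1 -> `|e| <= 1 ->
  `|radius p * e - radius p' * e'| <= d * `|p - p'| + (r + d) * `|e - e'|.
Proof.
move=> hp he; have /andP[_ h2] := radius_bounds hp.
have -> : radius p * e - radius p' * e' =
    d * (p - p') * e + radius p' * (e - e') by rewrite /radius; ring.
apply: le_trans (ler_normD _ _) _; rewrite !normrM; apply: lerD.
  by rewrite (gtr0_norm d0) ler_piMr// mulr_ge0// ltW.
by rewrite (gtr0_norm (radius_gt0 hp)) ler_wpM2r.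
Qed.

Let angle_dist (q q' : R) : `|2 * q - 1 - (2 * q' - 1)| = 2 * `|q - q'|.
Proof.
have -> : (2 * q - 1) - (2 * q' - 1) = 2 * (q - q') by ring.
by rewrite normrM ger0_norm.
Qed.

Let lipschitz_bound (p p' q q' : R) :
  d * `|p - p'| + (r + d) * (2 * `|q - q'|) <=
    2 * (r + d) * (`|p - p'| + `|q - q'|).
Proof.
have := mulr_ge0 (ltW r0) (normr_ge0 (p - p')).
by have := mulr_ge0 (ltW d0) (normr_ge0 (p - p')); lra.
Qed.

Lemma diamond_vel_lipschitz p q p' q' : 0 <= p' <= 1 -> 0 <= q <= 1 ->
  `|diamond_vel p q - diamond_vel p' q'| <=
    2 * (r + d) * (`|p - p'| + `|q - q'|).
Proof.
move=> hp' hq; apply: le_trans (product_dist _ _ hp' (angle_le1 hq)) _.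
by rewrite angle_dist; exact: lipschitz_bound.
Qed.

Lemma diamond_pos_lipschitz p q p' q' : 0 <= p' <= 1 -> 0 <= q <= 1 ->
  `|diamond_pos p q - diamond_pos p' q'| <=
    2 * (r + d) * (`|p - p'| + `|q - q'|).
Proof.
move=> hp' hq.
have e1 : `|1 - `|2 * q - 1| | <= 1.
  rewrite ler_norml; have := angle_le1 hq.
  by have := normr_ge0 (2 * q - 1); lra.
apply: le_trans (product_dist p (1 - `|2 * q' - 1|) hp' e1) _.
apply: le_trans (lipschitz_bound p p' q q'); rewrite lerD2l.
rewrite -angle_dist ler_wpM2l//; first by rewrite addr_ge0// ltW.
have -> : 1 - `|2 * q - 1| - (1 - `|2 * q' - 1|) =
  `|2 * q' - 1| - `|2 * q - 1| by ring.
by rewrite (distrC (2 * q - 1)); exact: ler_dist_dist.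
Qed.

End diamond.

Lemma dist_subr (R : numDomainType) (a a' s s' x y : R) :
  `|a - a'| <= x -> `|s - s'| <= y -> `|(a - s) - (a' - s')| <= x + y.
Proof.
move=> h1 h2; have -> : (a - s) - (a' - s') = (a - a') - (s - s') by ring.
by apply: le_trans (ler_normB _ _) _; exact: lerD.
Qed.

Section shooting.
Variable R : realType.
Local Notation mu := (@lebesgue_measure R).
Variables (b : R -> R) (T : R).
Hypothesis bL : mu.-integrable setT (EFin \o b).
Hypothesis T0 : 0 < T.
Hypothesis b0 : forall t, ~~ (0 < t <= T) -> b t = 0.
Hypothesis b_neg : int_oc b 0 T < 0.
Variables (p p' q' q : R).
Hypothesis p_ge0 : 0 <= p.
Hypothesis pp' : p < p'.
Hypothesis p'q' : p' < q'.
Hypothesis q'q : q' < q.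
Hypothesis qT : q <= T.
Hypothesis b_ge0 : forall t, p < t <= q -> 0 <= b t.
Hypothesis b_pos : 0 < int_oc b p' q'.
Variables (G : R -> R) (L c M : R).
Hypothesis L0 : 0 <= L.
Hypothesis GL : forall x y, `|G x - G y| <= L * `|x - y|.
Hypothesis G0 : forall s, s <= 0 -> G s = 0.
Hypothesis G_gt0 : forall s, 0 < s -> 0 < G s.
Hypothesis Gsmall : forall e, 0 < e -> exists2 r, 0 < r &
  forall s t, `|s| <= r -> `|t| <= r -> `|G s - G t| <= e * `|s - t|.
Hypothesis c0 : 0 < c.
Hypothesis M0 : 0 < M.
Hypothesis GM : forall s, M <= s -> c * s <= G s.

Definition boundary_values (bc : boundary_condition) (u v : R -> R) : Prop :=
  match bc with
  | Neumann => v 0 = 0 /\ v T = 0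
  | Periodic => u T = u 0 /\ v T = v 0
  end.

Section fixed_weight.
Variable nu : R.
Hypothesis nu0 : 0 < nu.
Let w t := nu * b t.
Let wL : mu.-integrable setT (EFin \o w).
Proof. exact: (integrableZl measurableT nu bL). Qed.
Let w0 t : ~~ (0 < t <= T) -> w t = 0.
Proof. by move=> /b0; rewrite /w => ->; rewrite mulr0. Qed.
Let w_neg : int_oc w 0 T < 0.
Proof. by rewrite int_ocZ// pmulr_rlt0. Qed.
Let w_ge0 t : p < t <= q -> 0 <= w t.
Proof. by move=> /b_ge0 ?; rewrite mulr_ge0// ltW. Qed.

Let d := Num.min (p' - p) (q - q').
Let k := 1 + T / d.
Hypothesis strong : (1 + k) / d < c / k * int_oc w p' q'.

Let hit u v x : ivp_sol w G 0 T u v -> 0 <= u 0 -> 0 < u 0 \/ 0 < v 0 ->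
  0 < x <= T -> u x <= 0 -> u T <= 0 /\ v T < 0.
Proof. exact: (hit_nonpos wL T0 w0 L0 GL G0). Qed.

Let end_in : 0 <= T <= T. Proof. by rewrite lexx ltW. Qed.

(** The first alternative serves the Neumann condition, where [v T = 0], the second the periodic
    one, where [u T = u 0]. *)
Lemma positive_of_end u v : ivp_sol w G 0 T u v -> 0 < u 0 ->
  0 <= v T \/ 0 < u T -> forall x, 0 <= x <= T -> 0 < u x.
Proof.
move=> suv u0 fin x /andP[]; rewrite le_eqVlt => /orP[/eqP <- //|x0 xT].
rewrite ltNge; apply/negP => ux; have x01 : 0 < x <= T by rewrite x0.
have [uT vT] := hit suv (ltW u0) (or_introl u0) x01 ux.
by case: fin => h; [move: vT; rewrite ltNge h|move: uT; rewrite leNgt h].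
Qed.

Lemma shooting_map : exists E (U V : R -> R -> R -> R), [/\ 0 < E,
  forall s y, ivp_sol w G 0 T (U s y) (V s y),
  forall s y, U s y 0 = s, forall s y, V s y 0 = y &
  forall s y s' y', `|U s y T - U s' y' T| + `|V s y T - V s' y' T| <=
    E * (`|s - s'| + `|y - y'|)].
Proof.
have [E E0 stab] := sol_stable wL T0 w0 L0 GL.
have /choice[Phi hPhi] (z : R * R) : exists uv : (R -> R) * (R -> R),
    [/\ ivp_sol w G 0 T uv.1 uv.2, uv.1 0 = z.1 & uv.2 0 = z.2].
  have [u [v [h1 h2 h3]]] := sol_exists wL T0 w0 L0 GL z.1 z.2.
  by exists (u, v).
pose U s y := (Phi (s, y)).1; pose V s y := (Phi (s, y)).2.
have sUV s y : ivp_sol w G 0 T (U s y) (V s y) by case: (hPhi (s, y)).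
have U0 s y : U s y 0 = s by case: (hPhi (s, y)).
have V0 s y : V s y 0 = y by case: (hPhi (s, y)).
exists E, U, V; split => // s y s' y'.
have [st _] := stab 0 T _ _ _ _ (lexx 0) (lexx T) (sUV s y) (sUV s' y').
by have := st T end_in; rewrite !U0 !V0.
Qed.

(** By uniqueness [u] is the line of slope [v 0], which stays in the region where [G] vanishes. *)
Lemma sol_from_zero u v : ivp_sol w G 0 T u v -> u 0 = 0 -> v 0 <= 0 ->
  u T = v 0 * T.
Proof.
move=> suv u0 v0; have [E E0 stab] := sol_stable wL T0 w0 L0 GL.
have neg x : 0 <= x <= T -> v 0 * (x - 0) <= 0.
  by move=> /andP[x0 _]; rewrite subr0 mulr_le0_ge0.
have [st _] := stab 0 T _ _ _ _ (lexx 0) (lexx T) suv (sol_affine wL G0 neg).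
have := st T end_in; rewrite u0 /cst !(subr0, subrr, mulr0) normr0 addr0 mulr0.
have := normr_ge0 (u T - v 0 * T); have := normr_ge0 (v T - v 0) => h1 h2 h3.
apply/eqP; rewrite -subr_eq0 -normr_le0; apply: le_trans h3.
by rewrite lerDl.
Qed.

(** Data with [u 0 = 0 >= v 0] escape [hit_nonpos]; there the explicit line gives the sign of
    [u T]. *)
Lemma large_end : exists2 rho, 0 < rho & forall u v, ivp_sol w G 0 T u v ->
  0 <= u 0 -> rho <= `|u 0| + `|v 0| ->
  u T <= 0 /\ (0 < u 0 \/ 0 < v 0 -> v T < 0).
Proof.
have [rho rho0 hlarge] := large_hit wL T0 w0 L0 GL G0 G_gt0 p_ge0 pp' p'q' q'q
  qT w_ge0 c0 M0 GM strong.
exists rho => // u v suv u0 big; have [x x0 ux] := hlarge u v suv u0 big.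
have [v0|v0] := ltrP 0 (v 0).
  have [uT vT] := hit suv u0 (or_intror v0) x0 ux.
  by split.
move: u0; rewrite le_eqVlt => /orP[/eqP u00|u0].
  rewrite (sol_from_zero suv (esym u00) v0); split.
    by rewrite mulr_le0_ge0// ltW.
  by case; rewrite -?u00 ?ltxx// ltNge v0.
have [uT vT] := hit suv (ltW u0) (or_introl u0) x0 ux.
by split.
Qed.

Let small_end := small_sign wL T0 w0 L0 GL G0 G_gt0 Gsmall w_neg.

Lemma neumann_solution : exists u v, [/\ ivp_sol w G 0 T u v,
  forall x, 0 <= x <= T -> 0 < u x & boundary_values Neumann u v].
Proof.
have [r r0 hsmall] := small_end; have [r1 r10 hlarge] := large_end.
have [E [U [V [E0 sUV U0 V0 lip]]]] := shooting_map.
pose Rb := r + r1; have rRb : r < Rb by rewrite ltrDl.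
have Rb0 : 0 < Rb by exact: lt_trans rRb.
pose f s := V s 0 T.
have cf : continuous f.
  apply: (@lipschitz_continuous _ _ E) => s s'.
  have := lip s 0 s' 0; rewrite subrr normr0 addr0; apply: le_trans.
  by rewrite lerDr.
have fr : 0 < f r.
  have h1 : 0 <= U r 0 0 by rewrite U0 ltW.
  have h2 : 0 < `|U r 0 0| + `|V r 0 0| <= r.
    by rewrite U0 V0 normr0 addr0 gtr0_norm// r0 lexx.
  have [+ _] := hsmall _ _ (sUV r 0) h1 h2.
  by rewrite V0 normr0 mul0r !subr0 => /(_ (normr_ge0 _)).
have fR : f Rb < 0.
  have h1 : 0 <= U Rb 0 0 by rewrite U0 ltW.
  have [|_] := hlarge _ _ (sUV Rb 0) h1.
    by rewrite U0 V0 normr0 addr0 gtr0_norm// lerDr ltW.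
  by apply; rewrite U0; left.
have [|s] := @IVT _ f r Rb 0 (ltW rRb) (continuous_subspaceT cf).
  by rewrite ge_min le_max (ltW fr) (ltW fR) orbT.
rewrite in_itv/= => /andP[rs _] fs0; exists (U s 0), (V s 0).
split; [exact: sUV| |by rewrite /boundary_values V0].
apply: (positive_of_end (sUV s 0)); first by rewrite U0; exact: lt_le_trans rs.
by left; rewrite -/(f s) fs0.
Qed.

Lemma periodic_solution : exists u v, [/\ ivp_sol w G 0 T u v,
  forall x, 0 <= x <= T -> 0 < u x & boundary_values Periodic u v].
Proof.
have [r r0 hsmall] := small_end; have [r1 r10 hlarge] := large_end.
have [E [U [V [E0 sUV U0 V0 lip]]]] := shooting_map.
(* The inner radius [r] is in the small-data range; the outer one, [r + r1], is beyond the threshold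
   of [large_end]. *)
pose S := diamond_pos r r1; pose Y := diamond_vel r r1.
pose F1 z z' := U (S z z') (Y z z') T - S z z'.
pose F2 z z' := V (S z z') (Y z z') T - Y z z'.
have I0 : 0 <= (0 : R) <= 1 by rewrite lexx ler01.
have I1 : 0 <= (1 : R) <= 1 by rewrite lexx ler01.
have rho_gt0 z : 0 <= z <= 1 -> 0 < radius r r1 z by exact: radius_gt0.
have S0 z z' : 0 <= z <= 1 -> 0 <= z' <= 1 -> 0 <= S z z'.
  exact: diamond_pos_ge0.
have SY z z' : 0 <= z <= 1 -> 0 <= z' <= 1 ->
    `|S z z'| + `|Y z z'| = radius r r1 z.
  exact: diamond_norm.
pose K := E * (4 * (r + r1)) + 2 * (r + r1).
have lipF z z1 z' z1' : 0 <= z1 <= 1 -> 0 <= z' <= 1 ->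
    `|F1 z z1 - F1 z' z1'| <= K * (`|z - z'| + `|z1 - z1'|) /\
    `|F2 z z1 - F2 z' z1'| <= K * (`|z - z'| + `|z1 - z1'|).
  move=> h1 h2; have hS := diamond_pos_lipschitz r0 r10 z z1' h2 h1.
  have hY := diamond_vel_lipschitz r0 r10 z z1' h2 h1.
  have h := lip (S z z1) (Y z z1) (S z' z1') (Y z' z1').
  have {}h := le_trans h (ler_wpM2l (ltW E0) (lerD hS hY)).
  have KE : K * (`|z - z'| + `|z1 - z1'|) =
      E * (2 * (r + r1) * (`|z - z'| + `|z1 - z1'|) +
        2 * (r + r1) * (`|z - z'| + `|z1 - z1'|)) +
      2 * (r + r1) * (`|z - z'| + `|z1 - z1'|) by rewrite /K; ring.
  rewrite KE; split.
    by apply: dist_subr hS; apply: le_trans h; rewrite lerDl.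
  by apply: dist_subr hY; apply: le_trans h; rewrite lerDr.
have bottom z : 0 <= z <= 1 -> F1 z 0 <= 0.
  move=> /rho_gt0 hz; have v0 : V 0 (- radius r r1 z) 0 <= 0.
    by rewrite V0 oppr_le0 ltW.
  rewrite /F1 /S /Y diamond_pos0 diamond_vel0 subr0.
  by rewrite (sol_from_zero (sUV _ _) (U0 _ _) v0) mulr_le0_ge0// ltW.
have T_in : 0 < T <= T by rewrite T0 lexx.
(* The left and right sides of the square are the inner and outer arcs; the bottom and top sides are
   the parts of [s = 0] with negative and positive velocity. *)
have [||||||||z [z' [z01 z'01]]] := @planar_zero R F1 F2 K.
- by move=> z z1 z' z1' _ h1 h2 _; case: (lipF z z1 z' z1' h1 h2).
- by move=> z z1 z' z1' _ h1 h2 _; case: (lipF z z1 z' z1' h1 h2).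
- exact: (bottom _ I0).
- have h1 : 0 <= U 0 r 0 by rewrite U0.
  have h2 : 0 < `|U 0 r 0| + `|V 0 r 0| <= r.
    by rewrite U0 V0 normr0 add0r gtr0_norm// r0 lexx.
  have [_] := hsmall _ _ (sUV 0 r) h1 h2.
  rewrite U0 V0 /F1 /S /Y diamond_pos1 diamond_vel1 radius0 subr0; exact.
- move=> z z01; have s0 := S0 _ _ I0 z01; have sy := SY _ _ I0 z01.
  rewrite /F1 /F2 => /eqP; rewrite subr_eq0 => /eqP UT.
  have h1 : 0 <= U (S 0 z) (Y 0 z) 0 by rewrite U0.
  have h2 : 0 < `|U (S 0 z) (Y 0 z) 0| + `|V (S 0 z) (Y 0 z) 0| <= r.
    by rewrite U0 V0 sy radius0 r0 lexx.
  have [h _] := hsmall _ _ (sUV (S 0 z) (Y 0 z)) h1 h2.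
  move: h; rewrite U0 V0 UT subrr sub0r normrN (normrM (Y 0 z)) (gtr0_norm T0).
  by apply.
- move=> z z01; have s0 := S0 _ _ I1 z01; have sy := SY _ _ I1 z01.
  have h1 : 0 <= U (S 1 z) (Y 1 z) 0 by rewrite U0.
  have [|UT _] := hlarge _ _ (sUV (S 1 z) (Y 1 z)) h1.
    by rewrite U0 V0 sy radius1 lerDr ltW.
  by rewrite /F1 subr_le0 (le_trans UT).
- exact: bottom.
- move=> z z01; rewrite /F1 /F2 /S /Y diamond_pos1 diamond_vel1 subr0 => UT.
  have hz := rho_gt0 _ z01; have s0 : 0 <= U 0 (radius r r1 z) 0 by rewrite U0.
  have [||_ vT] := hit (sUV 0 (radius r r1 z)) s0 _ T_in.
  + by right; rewrite V0.
  + by rewrite UT.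
  + by rewrite subr_lt0 (lt_trans vT).
rewrite /F1 /F2 => /eqP; rewrite subr_eq0 => /eqP UT.
move=> /eqP; rewrite subr_eq0 => /eqP VT.
exists (U (S z z') (Y z z')), (V (S z z') (Y z z')).
split; [exact: sUV| |by rewrite /boundary_values U0 V0].
have s0 := S0 _ _ z01 z'01; have sy := SY _ _ z01 z'01.
(* A common zero with [s = 0] is impossible: for [y > 0], [hit] gives [v T < 0 < y]; for [y <= 0]
   the solution is a line, so [u T = 0] forces [y = 0], against the positive radius. *)
have s_gt0 : 0 < S z z'.
  rewrite lt_neqAle s0 andbT eq_sym; apply/eqP => sE.
  rewrite sE in UT VT sy; have [y1|y1] := ltrP 0 (Y z z').
    have h1 : 0 <= U 0 (Y z z') 0 by rewrite U0.
    have [||_] := hit (sUV 0 (Y z z')) h1 _ T_in; first by right; rewrite V0.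
      by rewrite UT.
    by rewrite VT ltNge ltW.
  have v0 : V 0 (Y z z') 0 <= 0 by rewrite V0.
  move: UT; rewrite (sol_from_zero (sUV _ _) (U0 _ _) v0) V0 => /eqP.
  rewrite mulf_eq0 (gt_eqF T0) orbF => /eqP yE.
  by have := rho_gt0 _ z01; rewrite -sy yE !normr0 addr0 ltxx.
by apply: (positive_of_end (sUV _ _)); [rewrite U0|right; rewrite UT].
Qed.

End fixed_weight.

(** [nu_star] is the value of [nu] at which [strong] becomes an equality. *)
Lemma shooting_threshold : exists2 nu_star, 0 < nu_star &
  forall nu, nu_star < nu -> forall bc, exists u v,
    [/\ ivp_sol (fun t => nu * b t) G 0 T u v,
        forall x, 0 <= x <= T -> 0 < u x & boundary_values bc u v].
Proof.
pose d := Num.min (p' - p) (q - q'); pose k := 1 + T / d.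
have d0 : 0 < d by rewrite lt_min !subr_gt0 pp'.
have k0 : 0 < k by rewrite ltr_wpDr// divr_ge0 ?(ltW T0)// ltW.
have A0 : 0 < c / k * int_oc b p' q' by rewrite !mulr_gt0 ?invr_gt0.
exists ((1 + k) / d / (c / k * int_oc b p' q')).
  by rewrite !divr_gt0// addr_gt0.
move=> nu nu_lt bc.
have nu0 : 0 < nu by apply: lt_trans nu_lt; rewrite !divr_gt0// addr_gt0.
have strong : (1 + k) / d < c / k * int_oc (fun t => nu * b t) p' q'.
  by rewrite int_ocZ// mulrCA -ltr_pdivrMr.
by case: bc; [exact: neumann_solution|exact: periodic_solution].
Qed.
End shooting.

(** * One-sided derivatives and the truncated nonlinearity *)

Section derive_on.
Variable R : realType.
Implicit Types (D : set R) (f : R -> R).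

Lemma derivable_on_eps D f (x : R) : derivable_on D f x ->
  forall e, 0 < e -> exists2 d, 0 < d & forall y, D y -> `|y - x| < d ->
    `|f y - f x - derive_on D f x * (y - x)| <= e * `|y - x|.
Proof.
move=> /cvgrPdist_le cv e e0; have := cv e e0.
move=> -[d /= d0 hd]; exists d => // y Dy yx.
have [->|ynx] := eqVneq y x; first by rewrite !subrr mulr0 subrr normr0 mulr0.
have := hd y; rewrite /= distrC => /(_ yx) /(_ ynx) /(_ Dy).
rewrite -(ler_pM2r (_ : 0 < `|y - x|)) ?normr_gt0 ?subr_eq0//.
apply: le_trans; rewrite -normrM -normrN le_eqVlt; apply/orP; left; apply/eqP.
congr (`| _ |); rewrite /derive_on.
by field; rewrite subr_eq0.
Qed.

(** The first hypothesis makes the punctured filter within [D] proper, so that the limit [l] is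
    unique. *)
Lemma eps_derive_on D f (x l : R) :
  (forall e, 0 < e -> exists y, [/\ D y, y != x & `|y - x| < e]) ->
  (forall e, 0 < e -> exists2 d, 0 < d & forall y, D y -> `|y - x| < d ->
    `|f y - f x - l * (y - x)| <= e * `|y - x|) ->
  derivable_on D f x /\ derive_on D f x = l.
Proof.
move=> limpt fl.
have PF : ProperFilter (within D x^').
  apply: Build_ProperFilter_ex => A -[d /= d0 hd].
  have [y [Dy ynx yx]] := limpt _ d0; exists y; apply: hd => //=.
  by rewrite distrC.
have cv : quotients D f x --> l.
  apply/cvgrPdist_le => e e0; have [d d0 hd] := fl e e0.
  exists d => // y /= yx ynx Dy; rewrite distrC in yx.
  have := hd y Dy yx; rewrite -ler_pdivrMr ?normr_gt0 ?subr_eq0//.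
  apply: le_trans; rewrite -normfV -normrM -normrN le_eqVlt; apply/orP; left.
  by apply/eqP; congr (`| _ |); field; rewrite subr_eq0.
split; first by apply/cvg_ex; exists l.
by apply: cvg_lim => //; exact: Rhausdorff.
Qed.

Lemma itv_limit_point (T x : R) : 0 < T -> 0 <= x <= T ->
  forall e, 0 < e -> exists y, [/\ `[0, T]%classic y, y != x & `|y - x| < e].
Proof.
move=> T0 /andP[x0 xT] e e0; have [x2|x2] := ltrP x (T / 2).
  pose s := Num.min (e / 2) (T / 2); have s0 : 0 < s by rewrite lt_min !divr_gt0.
  have se : s <= e / 2 by rewrite ge_min lexx.
  have sT : s <= T / 2 by rewrite ge_min lexx orbT.
  exists (x + s); split; first by rewrite /= in_itv/=; lra.
    by rewrite -subr_eq0 addrAC subrr add0r gt_eqF.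
  by rewrite addrAC subrr add0r gtr0_norm//; lra.
pose s := Num.min (e / 2) (T / 2); have s0 : 0 < s by rewrite lt_min !divr_gt0.
have se : s <= e / 2 by rewrite ge_min lexx.
have sT : s <= T / 2 by rewrite ge_min lexx orbT.
exists (x - s); split; first by rewrite /= in_itv/=; lra.
  by rewrite -subr_eq0 addrAC subrr add0r oppr_eq0 gt_eqF.
by rewrite addrAC subrr add0r normrN gtr0_norm//; lra.
Qed.

End derive_on.

Section nonlinearity.
Variable R : realType.
Variable g : R -> R.
Local Notation D := (`[0 : R, +oo[%classic).
Hypothesis g_C1 : continuously_differentiable_on D g.
Hypothesis g_0 : g 0 = 0.
Hypothesis g_gt0 : forall s, 0 < s -> 0 < g s.
Local Notation dg := (derive_on D g).
Hypothesis dg_0 : dg 0 = 0.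
Variable dg_oo : R.
Hypothesis dg_lim : dg s @[s --> +oo] --> dg_oo.
Hypothesis dg_oo_gt0 : 0 < dg_oo.

Definition truncation (s : R) : R := g (Num.max s 0).

Let D_ge0 x : 0 <= x -> D x.
Proof. by rewrite /= in_itv/= andbT. Qed.

(** Interior points are positive, so the derivative restricted to the half-line is two-sided there;
    at the endpoints derivability yields continuity. *)
Lemma g_increment x y : 0 <= x -> x <= y ->
  exists2 c, x <= c <= y & g y - g x = dg c * (y - x).
Proof.
move=> x0 xy; have [gd _] := g_C1.
have [||c + ->] := @MVT_segment _ g dg x y xy.
- move=> z; rewrite in_itv/= => /andP[xz zy].
  have z0 : 0 < z by exact: le_lt_trans xz.
  apply: is_derive_eps => e e0.
  have [d d0 hd] := derivable_on_eps (gd z (D_ge0 (ltW z0))) e0.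
  exists (Num.min d z); first by rewrite lt_min d0 z0.
  move=> t; rewrite lt_min => /andP[td tz]; apply: hd => //; apply: D_ge0.
  by move: tz; rewrite ltr_norml; lra.
- apply/subspace_continuousP => z; rewrite /= in_itv/= => /andP[xz zy].
  have z0 : 0 <= z by exact: le_trans xz.
  apply/cvgrPdist_lt => e e0.
  have [d d0 hd] := derivable_on_eps (gd z (D_ge0 z0)) ltr01.
  pose C := 1 + `|dg z|; have C0 : 0 < C by rewrite ltr_pwDl.
  near=> t.
  have xt : x <= t.
    have : `[x, y]%classic t by near: t; exact: withinT.
    by rewrite /= in_itv/= => /andP[].
  have td : `|t - z| < Num.min d (e / C).
    rewrite distrC; near: t; apply: cvg_within.
    apply/nbhs_ballP; exists (Num.min d (e / C)) => //=.
    rewrite lt_min; apply/andP; split; [exact: d0|exact: divr_gt0 e0 C0].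
  move: td; rewrite lt_min => /andP[td te].
  have := hd t (D_ge0 (le_trans x0 xt)) td; rewrite mul1r => h.
  rewrite distrC -(subrK (dg z * (t - z)) (g t - g z)).
  apply: le_lt_trans (ler_normD _ _) _; apply: le_lt_trans (lerD h (lexx _)) _.
  rewrite normrM -{1}(mul1r `|t - z|) -mulrDl -/C mulrC -ltr_pdivlMr//.
- by rewrite in_itv/= => xcy; exists c.
Unshelve. all: by end_near. Qed.

Lemma dg_continuous x e : 0 <= x -> 0 < e -> exists2 d, 0 < d &
  forall y, 0 <= y -> `|y - x| < d -> `|dg y - dg x| < e.
Proof.
move=> x0 e0; have [_ /subspace_continuousP] := g_C1.
move=> /(_ x (D_ge0 x0)) /cvgrPdist_lt /(_ e e0) [d /= d0 hd].
exists d => // y y0 yx; rewrite distrC; apply: hd; last exact: D_ge0.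
by rewrite /= distrC.
Qed.

Lemma dg_near_oo e : 0 < e -> exists2 S, 0 < S &
  forall s, S <= s -> `|dg s - dg_oo| < e.
Proof.
move=> e0; have /cvgrPdist_lt /(_ e e0) [S [_ hS]] := dg_lim.
exists (Num.max (S + 1) 1); first by rewrite lt_max ltr01 orbT.
move=> s; rewrite ge_max => /andP[Ss _]; rewrite distrC; apply: hS.
by apply: lt_le_trans Ss; rewrite ltrDl.
Qed.

Lemma dg_bounded : exists2 L, 0 <= L & forall s, 0 <= s -> `|dg s| <= L.
Proof.
have [S S0 hS] := dg_near_oo ltr01.
have cd : {within `[0, S], continuous (fun s => `|dg s|)}.
  apply/subspace_continuousP => z; rewrite /= in_itv/= => /andP[z0 zS].
  apply/cvgrPdist_lt => e e0; have [d d0 hd] := dg_continuous z0 e0.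
  near=> t.
  have t0 : 0 <= t.
    have : `[0, S]%classic t by near: t; exact: withinT.
    by rewrite /= in_itv/= => /andP[].
  apply: le_lt_trans (ler_dist_dist _ _) _; rewrite distrC; apply: hd => //.
  rewrite distrC; near: t; apply: cvg_within.
  by apply/nbhs_ballP; exists d.
have [c _ hc] := EVT_max (ltW S0) cd.
exists (`|dg c| + (`|dg_oo| + 1)); first by rewrite !addr_ge0.
move=> s s0; have [sS|Ss] := lerP s S.
  have := hc s; rewrite in_itv/= s0 sS => /(_ isT) h.
  by apply: le_trans h _; rewrite lerDl addr_ge0.
have h := hS _ (ltW Ss).
have : `|dg s| <= `|dg s - dg_oo| + `|dg_oo|.
  by rewrite -{1}(subrK dg_oo (dg s)) ler_normD.
by have := normr_ge0 (dg c); lra.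
Unshelve. all: by end_near. Qed.

Lemma g_dist r L s t : 0 <= s <= r -> 0 <= t <= r ->
  (forall c, 0 <= c <= r -> `|dg c| <= L) -> `|g s - g t| <= L * `|s - t|.
Proof.
have H x y : 0 <= x -> x <= y <= r -> (forall c, 0 <= c <= r -> `|dg c| <= L) ->
    `|g y - g x| <= L * `|y - x|.
  move=> x0 /andP[xy yr] hL.
  have [c /andP[xc cy] ->] := g_increment x0 xy.
  by rewrite normrM ler_wpM2r// hL// (le_trans x0 xc) (le_trans cy yr).
move=> /andP[s0 sr] /andP[t0 tr] hL; have [st|ts] := leP s t.
  by rewrite distrC (distrC s); apply: H => //; rewrite st.
by apply: H => //; rewrite sr ltW.
Qed.

Lemma max0_dist (s t : R) : `|Num.max s 0 - Num.max t 0| <= `|s - t|.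
Proof.
have H u v : u <= v -> `|Num.max u 0 - Num.max v 0| <= v - u :> R.
  move=> uv; rewrite ler_norml /Num.max.
  by do !case: ifP => //; do ?[move/negbT; rewrite -leNgt => ?|move=> ?]; lra.
have [st|ts] := lerP s t; first exact: H.
by rewrite distrC H// ltW.
Qed.

Let max0_ge0 (s : R) : 0 <= Num.max s 0. Proof. by rewrite le_max lexx orbT. Qed.

Lemma truncation_lipschitz : exists2 L, 0 <= L &
  forall s t, `|truncation s - truncation t| <= L * `|s - t|.
Proof.
have [L L0 hL] := dg_bounded; exists L => // s t.
apply: le_trans (_ : L * `|Num.max s 0 - Num.max t 0| <= _); last first.
  by rewrite ler_wpM2l ?max0_dist.
apply: (@g_dist (Num.max (Num.max s 0) (Num.max t 0))).
- by rewrite max0_ge0 le_max lexx.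
- by rewrite max0_ge0 le_max lexx orbT.
- by move=> c /andP[c0 _]; exact: hL.
Qed.

Lemma truncation_le0 s : s <= 0 -> truncation s = 0.
Proof. by move=> s0; rewrite /truncation (max_idPr s0). Qed.

Lemma truncation_gt0 s : 0 < s -> 0 < truncation s.
Proof. by move=> s0; rewrite /truncation (max_idPl (ltW s0)) g_gt0. Qed.

Lemma truncation_small e : 0 < e -> exists2 r, 0 < r & forall s t,
  `|s| <= r -> `|t| <= r -> `|truncation s - truncation t| <= e * `|s - t|.
Proof.
move=> e0; have [d d0 hd] := dg_continuous (lexx 0) e0.
exists (d / 2); first by rewrite divr_gt0.
move=> s t sd td.
apply: le_trans (_ : e * `|Num.max s 0 - Num.max t 0| <= _); last first.
  by rewrite ler_wpM2l ?max0_dist// ltW.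
have d20 : 0 <= d / 2 by rewrite divr_ge0// ltW.
apply: (@g_dist (d / 2)).
- by rewrite max0_ge0 ge_max (le_trans (ler_norm s) sd).
- by rewrite max0_ge0 ge_max (le_trans (ler_norm t) td).
- move=> c /andP[c0 cd]; have := hd c c0; rewrite subr0 ger0_norm// dg_0 subr0.
  by move=> h; apply/ltW/h; lra.
Qed.

(** Beyond [S] the derivative is at least [dg_oo / 2]; for [s >= 2 * S] the length [s - S] is at
    least [s / 2], whence the constant [dg_oo / 4]. *)
Lemma truncation_large : exists c M, [/\ 0 < c, 0 < M &
  forall s, M <= s -> c * s <= truncation s].
Proof.
have h2 : 0 < dg_oo / 2 by rewrite divr_gt0.
have [S S0 hS] := dg_near_oo h2.
exists (dg_oo / 4), (2 * S); split; [by rewrite divr_gt0|by rewrite mulr_gt0|].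
move=> s Ss; have Sle : S <= s by lra.
have s0 : 0 <= s by lra.
rewrite /truncation (max_idPl s0).
have [c /andP[Sc cs] gE] := g_increment (ltW S0) Sle.
have := hS c Sc; rewrite ltr_norml => /andP[h _].
have h3 : dg_oo / 2 <= dg c by lra.
have sS0 : 0 <= s - S by lra.
have h4 := ler_wpM2r sS0 h3; have h5 := g_gt0 S0.
have h6 := ler_wpM2l (ltW dg_oo_gt0) Ss.
by lra.
Qed.

End nonlinearity.

(** * Completed and Borel measurability *)

Section completion.
Variable R : realType.
Local Notation mu := (@lebesgue_measure R).

Lemma measurable_completed (A : set R) :
  measurable (A : set (measurableTypeR R)) ->
  (wlength idfun)^*%mu.-cara.-measurable A.
Proof. exact: sub_caratheodory. Qed.

Lemma completed_measurableE (A : set R) :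
  (wlength idfun)^*%mu.-cara.-measurable A ->
  exists B N : set R, [/\ measurable (B : set (measurableTypeR R)),
    mu.-negligible (N : set (measurableTypeR R)) & A = B `|` N].
Proof.
move=> mA.
have := mA; rewrite -completed_caratheodory_measurable.
rewrite g_sigma_completed_algebra_genE => -[B mB [N nN BN]].
by exists B, N; split.
Qed.

Lemma negligible_completed (A : set R) :
  (leb R).-negligible A <-> mu.-negligible (A : set (measurableTypeR R)).
Proof.
split=> [[B [mB B0 AB]]|[B [mB B0 AB]]].
  have [C [N [mC nN BE]]] := completed_measurableE mB.
  apply: (@negligibleS _ _ _ mu B A AB); rewrite BE; apply: negligibleU => //.
  exists C; split => //.
  apply/eqP; rewrite eq_le measure_ge0 andbT -B0.
  by apply: le_outer_measure; rewrite BE; exact: subsetUl.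
by exists B; split => //; exact: measurable_completed.
Qed.

(* The exceptional null sets of the countably many level sets [a > r], with [r]
   rational, are discarded together. *)
Lemma borel_restriction (E : set R) (a : R -> R) :
  measurable (E : set (measurableTypeR R)) ->
  @measurable_fun _ _ (caratheodory_type (wlength (@idfun R))^*%mu) _ E a ->
  exists N : set (measurableTypeR R), [/\ measurable N, mu N = 0 &
    forall M : set (measurableTypeR R), measurable M -> N `<=` M ->
    measurable_fun ((E `\` M) : set (measurableTypeR R)) a].
Proof.
move=> mE ma.
have cut (r : rat) : exists BN : set R * set R,
    [/\ measurable (BN.1 : set (measurableTypeR R)),
      measurable (BN.2 : set (measurableTypeR R)), mu BN.2 = 0,
      BN.1 `<=` E `&` [set x | ratr r < a x] &
      E `&` [set x | ratr r < a x] `<=` BN.1 `|` BN.2].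
  have mEr : (wlength idfun)^*%mu.-cara.-measurable
      (E `&` [set x | ratr r < a x]).
    rewrite -preimage_itvoy; apply: ma; first exact: measurable_completed.
    exact: measurable_itv.
  have [B [N [mB [M [mM M0 NM]] BNE]]] := completed_measurableE mEr.
  exists (B, M); split => //=; first by rewrite BNE; exact: subsetUl.
  by rewrite BNE; exact: setUS.
have /choice[BN hBN] := cut.
pose F n := if unpickle n is Some r then (BN r).2 else set0.
have nF n : mu.-negligible (F n : set (measurableTypeR R)).
  rewrite /F; case: unpickle => [r|]; last exact: negligible_set0.
  by have [_ m2 m20 _ _] := hBN r; exists (BN r).2; split.
have [N [mN N0 FN]] := negligible_bigcup nF.
exists N; split => // M mM NM.
move=> mEM; apply: (measurability _ (RGenOInfty.measurableE R)) => //.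
move=> /= _ [_ [x ->] <-]; rewrite preimage_itvoy.
have -> : (E `\` M) `&` [set y | x < a y] =
    \bigcup_(r : rat) (if x <= ratr r then (BN r).1 `\` M else set0).
  apply/seteqP; split=> [y [[Ey My] /= xay]|y [r _]].
    have [r] := rat_in_itvoo xay; rewrite in_itv/= => /andP[xr ray].
    exists r => //; rewrite (ltW xr).
    have [_ _ _ _ sub] := hBN r.
    have [//|Nry] := sub y (conj Ey ray).
    have Fy : F (pickle r) y by rewrite /F pickleK.
    by case: My; apply: NM; apply: FN; exact: (bigcup_sup I Fy).
  case: ifPn => // xr [By My]; have [_ _ _ sub _] := hBN r.
  have [Ey ray] := sub y By; split => //=.
  exact: le_lt_trans ray.
apply: bigcupT_measurable_rat => r; case: ifPn => // _.
by apply: measurableD => //; case: (hBN r).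
Qed.

(** Change of variables along [phi], the identity seen as a map from the completed to the Borel
    sigma-algebra; it pushes the completed measure forward to [mu]. *)
Lemma completed_integral (E : set (measurableTypeR R)) (f : R -> R) :
  measurable E -> measurable_fun [set: measurableTypeR R] f ->
  (leb R).-integrable [set: _] (EFin \o f) ->
  mu.-integrable [set: measurableTypeR R] (EFin \o f) /\
  \int[leb R]_(x in E) f x = \int[mu]_(x in E) f x.
Proof.
move=> mE mf fL.
pose phi (x : caratheodory_type (wlength (@idfun R))^*%mu) :
  measurableTypeR R := x.
have mphi : measurable_fun setT phi.
  by move=> _ A mA; rewrite setTI; exact: measurable_completed.
have mEf : measurable_fun [set: measurableTypeR R] (EFin \o f).
  exact/measurable_EFinP.
split.
  exact: (@integrable_pushforward _ _ _ _ _ phi mphi (leb R) setT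
    (EFin \o f) mEf fL).
rewrite /Rintegral; congr fine; apply/esym.
apply: (@integral_pushforward _ _ _ _ _ phi mphi (leb R) E (EFin \o f) mEf) => //.
apply: integrableS fL => //.
exact: measurable_completed.
Qed.

(** One null set [M] collects the point 0, a set off which [a] is Borel on [[0, T]], and the points
    of [J] with [a < 0]; setting [b] to 0 on [M] makes the almost everywhere properties hold
    pointwise. *)
Lemma borel_version (T : R) (J : set R) (a : R -> R) :
  (leb R).-integrable `[0, T] (EFin \o a) ->
  {ae leb R, forall x : R, J x -> 0 <= a x} ->
  exists b : R -> R, [/\ mu.-integrable [set: measurableTypeR R] (EFin \o b),
    forall t, ~~ (0 < t <= T) -> b t = 0,
    forall t, J t -> 0 <= b t,
    {ae leb R, forall x : R, `[0, T]%classic x -> a x = b x} &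
    forall E : set (measurableTypeR R), measurable E -> E `<=` `[0, T] ->
      \int[leb R]_(x in E) a x = \int[mu]_(x in E) b x].
Proof.
move=> aL aJ.
have mI : measurable (`[0, T]%classic : set (measurableTypeR R)).
  exact: measurable_itv.
have ma := measurable_int _ aL; move/measurable_EFinP in ma.
have [N [mN N0 hN]] := borel_restriction mI ma.
have [NJ [mNJ NJ0 hNJ]] := (negligible_completed _).1 aJ.
pose M : set (measurableTypeR R) := [set 0] `|` N `|` NJ.
have mM : measurable M.
  by apply: measurableU => //; apply: measurableU => //; exact: measurable_set1.
have nM : mu.-negligible M.
  apply: negligibleU; last by exists NJ; split.
  apply: negligibleU; last by exists N; split.
  exists [set 0]; split => //; exact: lebesgue_measure_set1.
pose D : set (measurableTypeR R) := `[0, T]%classic `\` M.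
have mD : measurable D by exact: measurableD.
pose b := a \_ D.
have bE t : b t = if t \in D then a t else 0 by rewrite /b patchE.
have mb : measurable_fun [set: measurableTypeR R] b.
  apply/measurable_restrict => //; rewrite setTI.
  by apply: hN => //; move=> x Nx; left; right.
have mDc := measurable_completed mD.
have bLc : (leb R).-integrable [set: _] (EFin \o b).
  have -> : EFin \o b = (EFin \o a) \_ D by rewrite -restrict_EFin.
  apply/(integrable_mkcond _ _).1 => //.
  apply: integrableS aL => //; first exact: measurable_completed.
  exact: subDsetl.
have ab : {ae leb R, forall x : R, `[0, T]%classic x -> a x = b x}.
  apply/negligible_completed; apply: negligibleS nM => x /= /not_implyP[xI abx].
  apply: contrapT => Mx; apply: abx; rewrite bE mem_set//.
exists b; split => //.
- by have [] := completed_integral mI mb bLc.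
- move=> t t0; rewrite bE; case: ifPn => //; rewrite inE => -[/= + Mt].
  rewrite in_itv/= => /andP[t1 t2]; exfalso; move/negP: t0; apply.
  rewrite t2 andbT lt_neqAle t1 andbT; apply/eqP => t00; apply: Mt; left; left.
  by rewrite /= t00.
- move=> t Jt; rewrite bE; case: ifPn => //; rewrite inE => -[_ Mt].
  rewrite leNgt; apply/negP => at0; apply: Mt; right; apply: hNJ => /= h.
  by have := h Jt; rewrite leNgt at0.
- move=> E mE EI; have [_ <-] := completed_integral mE mb bLc.
  rewrite /Rintegral; congr fine; apply: ae_eq_integral.
  + exact: measurable_completed.
  + apply: measurable_int; apply: integrableS aL => //; exact: measurable_completed.
  + apply: measurable_int; apply: integrableS bLc => //; exact: measurable_completed.
  + move: ab; apply: filterS; first exact: (ae_filter_ringOfSetsType (leb R)).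
    by move=> x abx Ex; congr EFin; exact: (abx (EI _ Ex)).
Qed.
End completion.

(** * Back to the boundary value problem *)

Section assembly.
Variable R : realType.
Local Notation mu := (@lebesgue_measure R).
Local Notation L1 f := (mu.-integrable setT (EFin \o f)).

(** Absolute continuity of the integral is applied to the union of the disjoint intervals, whose
    measure is the sum of their lengths. *)
Lemma primitive_absolutely_continuous (f v : R -> R) (a b : R) : L1 f ->
  (forall x y, a <= x -> x <= y -> y <= b -> v y - v x = - int_oc f x y) ->
  absolutely_continuous_on a b v.
Proof.
move=> fL dv e e0; have [d [d0 hd]] := integral_normr_continuous fL e0.
exists d => // n s t st tI len.
pose F i : set (measurableTypeR R) := `]s i, t i[%classic.
have mF i : measurable (F i) by exact: measurable_itv.
have muF : mu (\big[setU/set0]_(i < n) F i) = (\sum_(i < n) (t i - s i))%:E.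
  rewrite (measure_semi_additive_ord mu)//; last exact: bigsetU_measurable.
  rewrite -sumEFin; apply: eq_bigr => i _; have [_ [sti _]] := st i.
  have := @lebesgue_measure_itv R `]s i, t i[; rewrite /= lte_fin => ->.
  have [_|ts] := ltrP (s i) (t i); first by rewrite -EFinB.
  by rewrite (_ : s i = t i) ?subrr//; apply/eqP; rewrite eq_le sti.
have mA : measurable (\big[setU/set0]_(i < n) F i) by exact: bigsetU_measurable.
have muA : (mu (\big[setU/set0]_(i < n) F i) < d%:E)%E by rewrite muF lte_fin.
have := hd _ mA muA.
have nL := L1_norm fL.
apply: le_lt_trans; rewrite -lee_fin -sumEFin.
have finA : (\int[mu]_(x in \big[setU/set0]_(i < n) F i) (`|f x|)%:E)%E
    \is a fin_num.
  by apply: integrable_fin_num => //; apply: integrableS nL.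
rewrite /Rintegral fineK// (@ge0_integral_bigsetU _ _ _ mu _ F)//.
- apply: lee_sum => i _; have [asi [sti tib]] := st i.
  rewrite dv// normrN.
  apply: (@le_trans _ _ (int_oc (fun t => `|f t|) (s i) (t i))%:E).
    by rewrite lee_fin norm_int_oc.
  rewrite /int_oc /Rintegral fineK; last first.
    apply: integrable_fin_num; first exact: measurable_itv.
    by apply: (integrableS measurableT _ _ nL) => //; exact: measurable_itv.
  rewrite (integral_itv_bndoo false false)//.
  by apply: (measurable_int mu); apply: integrableS nL.
- exact: index_enum_uniq.
- by apply: sub_trivIset tI.
- by apply: (measurable_int mu); apply: integrableS nL.
Qed.

Lemma bounded_itv (J : interval R) (a b : R) : [set` J] `<=` `[a, b] ->
  [set` J] !=set0 -> exists b0 b1 p q, J = Interval (BSide b0 p) (BSide b1 q).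
Proof.
move=> JI [x Jx]; have /= := JI _ Jx; rewrite in_itv/= => /andP[ax xb].
case: J JI Jx => -[b0 p|[|]] [b1 q|[|]] JI /= Jx; first by exists b0, b1, p, q.
all: try by move: Jx; rewrite in_itv/= ?andbF.
- have /JI /= : x + (b - x + 1) \in Interval (BSide b0 p) +oo%O.
    move: Jx; rewrite !in_itv/= !andbT; case: b0 {JI} => /= px; lra.
  by rewrite in_itv/=; lra.
- have /JI /= : x - (x - a + 1) \in Interval -oo%O (BSide b1 q).
    move: Jx; rewrite !in_itv/=; case: b1 {JI} => /= px; lra.
  by rewrite in_itv/=; lra.
- have /JI /= : a - 1 \in (Interval -oo%O +oo%O : interval R) by rewrite in_itv.
  by rewrite in_itv/=; lra.
Qed.

Lemma interior_window (b : R -> R) (J : interval R) (T : R) : L1 b ->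
  [set` J] `<=` `[0, T] -> 0 < \int[mu]_(x in [set` J]) b x ->
  (forall t, t \in J -> 0 <= b t) ->
  exists p p' q' q, [/\ [/\ 0 <= p, p < p', p' < q', q' < q & q <= T],
    forall t, p < t <= q -> 0 <= b t & 0 < int_oc b p' q'].
Proof.
move=> bL JI Jpos b_ge0.
have J0 : [set` J] !=set0.
  apply: contrapT => /nonemptyPn J0.
  by move: Jpos; rewrite J0 Rintegral_set0 ltxx.
have [b0 [b1 [p [q JE]]]] := bounded_itv JI J0.
have bm : measurable_fun `]p, q[ (EFin \o b).
  by apply: (measurable_int mu); apply: integrableS bL.
have Jint : \int[mu]_(x in [set` J]) b x = int_oc b p q.
  rewrite JE /int_oc /Rintegral (integral_itv_bndoo b0 b1)//.
  by rewrite (integral_itv_bndoo false false).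
rewrite Jint in Jpos; have pq : p < q.
  by rewrite ltNge; apply/negP => qp; move: Jpos; rewrite int_oc_ge ?ltxx.
have inJ t : p < t < q -> t \in J.
  move=> /andP[pt tq]; rewrite JE in_itv/=.
  by case: (b0) (b1) => -[] /=; rewrite ?pt ?tq ?(ltW pt) ?(ltW tq).
have p0 : 0 <= p.
  rewrite leNgt; apply/negP => pn.
  pose x := (p + Num.min 0 q) / 2.
  have m1 : p < Num.min 0 q by rewrite lt_min pn.
  have m2 : Num.min 0 q <= 0 by rewrite ge_min lexx.
  have m3 : Num.min 0 q <= q by rewrite ge_min lexx orbT.
  have /inJ /JI /= : p < x < q by rewrite /x; apply/andP; split; lra.
  by rewrite in_itv/= /x; lra.
have qT : q <= T.
  rewrite leNgt; apply/negP => pn.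
  pose x := (q + Num.max T p) / 2.
  have m1 : Num.max T p < q by rewrite gt_max pn.
  have m2 : T <= Num.max T p by rewrite le_max lexx.
  have m3 : p <= Num.max T p by rewrite le_max lexx orbT.
  have /inJ /JI /= : p < x < q by rewrite /x; apply/andP; split; lra.
  by rewrite in_itv/= /x; lra.
set I := int_oc b p q in Jpos.
have I4 : 0 < I / 4 by rewrite divr_gt0.
have [d d0 hd] := int_oc_cont bL I4.
(* Trimming [s] on the left and [2 * s] on the right loses less than half of the integral. The outer
   window stops at [q - s] because it is closed on the right and [J] may omit [q]. *)
pose s := Num.min d (q - p) / 4.
have s0 : 0 < s by rewrite divr_gt0// lt_min d0 subr_gt0.
have sd : 4 * s <= d by rewrite /s mulrC divfK ?pnatr_eq0// ge_min lexx.
have sq : 4 * s <= q - p by rewrite /s mulrC divfK ?pnatr_eq0// ge_min lexx orbT.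
exists p, (p + s), (q - 2 * s), (q - s); split; [split; lra| |].
  by move=> t /andP[pt tq]; apply/b_ge0/inJ; rewrite pt /=; lra.
have m1 : p <= p + s by lra.
have m2 : p + s <= q by lra.
have m3 : p + s <= q - 2 * s by lra.
have m4 : q - 2 * s <= q by lra.
have e1 := int_ocD bL m1 m2; have e2 := int_ocD bL m3 m4.
have e3 := norm_int_oc p (p + s) bL; have e4 := norm_int_oc (q - 2 * s) q bL.
have e5 : int_oc (fun t => `|b t|) p (p + s) < I / 4 by apply: hd; lra.
have e6 : int_oc (fun t => `|b t|) (q - 2 * s) q < I / 4 by apply: hd; lra.
have e7 := ler_norm (int_oc b p (p + s)).
have e8 := ler_norm (int_oc b (q - 2 * s) q).
rewrite -/I in e1; lra.
Qed.

Lemma sol_positive_solution bc (T nu : R) (a b g u v : R -> R) L :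
  0 < T -> 0 <= L ->
  L1 b -> (forall t, ~~ (0 < t <= T) -> b t = 0) ->
  {ae leb R, forall x : R, `[0, T]%classic x -> a x = b x} ->
  (forall s t, `|truncation g s - truncation g t| <= L * `|s - t|) ->
  ivp_sol (fun t => nu * b t) (truncation g) 0 T u v ->
  (forall x, 0 <= x <= T -> 0 < u x) -> boundary_values T bc u v ->
  positive_solution bc T (fun x s => nu * a x * g s) u.
Proof.
move=> T0 L0 bL b0 ab GL suv upos bdry; have [cu du dv] := suv.
have wL : L1 (fun t => nu * b t) by exact: (integrableZl measurableT nu bL).
have w0 t : ~~ (0 < t <= T) -> nu * b t = 0 by move=> /b0 ->; rewrite mulr0.
pose f t := nu * b t * truncation g (u t).
have fL : L1 f by exact: (L1_force wL T0 w0 GL cu).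
have limpt x : 0 <= x <= T -> forall e, 0 < e ->
    exists y, [/\ `[0, T]%classic y, y != x & `|y - x| < e].
  exact: itv_limit_point.
have itvE x : `[0, T]%classic x <-> 0 <= x <= T by rewrite /= in_itv.
have uD x : 0 <= x <= T -> derivable_on `[0, T]%classic u x /\
    derive_on `[0, T]%classic u x = v x.
  move=> x01; apply: eps_derive_on; first exact: limpt.
  move=> e e0; have [d d0 hd] := is_derive_epsP (du x x01) e0.
  by exists d => // y _; exact: hd.
have uDE x : 0 <= x <= T -> derive_on `[0, T]%classic u x = v x by move=> /uD[].
have dv' x y : 0 <= x -> x <= y -> y <= T ->
    derive_on `[0, T]%classic u y - derive_on `[0, T]%classic u x = - int_oc f x y.
  move=> x0 xy yT; rewrite !uDE ?dv//; first by rewrite x0 (le_trans xy).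
  by rewrite (le_trans x0 xy).
split=> //; split.
- split=> [x /itvE/uD[]//|].
  apply/subspace_continuousP => x /itvE x01; apply/cvgrPdist_lt => e e0.
  have [d d0 hd] := int_oc_cont fL e0.
  near=> y.
  have y01 : 0 <= y <= T by apply/itvE; near: y; exact: withinT.
  have xyd : `|x - y| < d.
    by near: y; apply: cvg_within; apply/nbhs_ballP; exists d.
  have /andP[x0 xT] := x01; have /andP[y0 yT] := y01.
  have [xy|yx] := lerP x y.
    rewrite distrC dv'// normrN; apply: le_lt_trans (norm_int_oc _ _ fL) _.
    by apply: hd; move: xyd; rewrite ltr_norml; lra.
  rewrite dv'//; last exact: ltW.
  rewrite normrN; apply: le_lt_trans (norm_int_oc _ _ fL) _.
  by apply: hd; move: xyd; rewrite ltr_norml; lra.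
- exact: primitive_absolutely_continuous fL dv'.
(* By Lebesgue differentiation the primitive of [f] from -oo has derivative [f x] at almost every
   [x]; its increments are opposite to those of the derivative of [u] on [[0, T]]. *)
- have fLy y : mu.-integrable `]-oo, y] (EFin \o f) by exact: integrableS fL.
  have floc : locally_integrable [set: R] f.
    exact: open_integrable_locally openT fL.
  have /negligible_completed := FTC1Ny fLy floc.
  move: ab; apply: filterS2; first exact: (ae_filter_ringOfSetsType (leb R)).
  move=> x abx [dF FE] xI; have x01 := (itvE x).1 xI.
  have dF' : is_derive x 1 (fun y => \int[mu]_(t in `]-oo, y]) f t) (f x).
    exact: (DeriveDef dF (etrans (esym (derive1E _ _)) FE)).
  have FB y z : y <= z -> \int[mu]_(t in `]-oo, z]) f t -
      \int[mu]_(t in `]-oo, y]) f t = int_oc f y z.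
    by move=> yz; rewrite Rintegral_itvB.
  have [|e e0|D1 D2] := @eps_derive_on _ `[0, T]%classic
      (derive_on `[0, T]%classic u) x (- f x).
  + exact: limpt.
  + have [d d0 hd] := is_derive_epsP dF' e0; exists d => // y /itvE y01 yxd.
    have /andP[x0 xT] := x01; have /andP[y0 yT] := y01.
    have := hd y yxd; have [xy|yx] := lerP x y.
      rewrite FB// (dv' x y)//.
      apply: le_trans; rewrite -normrN le_eqVlt; apply/orP; left.
      by apply/eqP; congr (`| _ |); ring.
    rewrite -(opprB (\int[mu]_(t in `]-oo, x]) f t)) FB ?(ltW yx)//.
    rewrite -(opprB (derive_on _ u x)) (dv' y x) ?(ltW yx)//.
    apply: le_trans; rewrite -normrN le_eqVlt; apply/orP; left.
    by apply/eqP; congr (`| _ |); ring.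
  (* Positivity of [u] turns [truncation g] back into [g]. *)
  split => //; rewrite D2 /f abx// /truncation (max_idPl _) ?subrr// ?ltW ?upos//.
  by rewrite addrC subrr.
- have T01 : 0 <= T <= T by rewrite lexx ltW.
  have z01 : 0 <= (0 : R) <= T by rewrite lexx ltW.
  rewrite /boundary_operator /=; case: bc bdry => /= -[h1 h2].
    by rewrite !uDE// h1 h2.
  by rewrite !uDE// h1 h2 !subrr.
Unshelve. all: by end_near. Qed.

End assembly.

Theorem theorem1p3 (R : realType) (bc : boundary_condition)
  (T : R) (T_gt0 : 0 < T)
  (a : R -> R) (a_int : (leb R).-integrable `[0, T] (fun x => (a x)%:E))
  (J : interval R) (J_sub : [set` J] `<=` `[0, T])
  (a_ge0 : {ae leb R, forall x : R, x \in J -> 0 <= a x})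
  (int_a_lt0 : \int[leb R]_(x in `[0, T]) a x < 0)
  (int_J_gt0 : 0 < \int[leb R]_(x in [set` J]) a x)
  (g : R -> R) (g_ge0 : forall s, 0 <= s -> 0 <= g s)
  (g_C1 : continuously_differentiable_on `[0, +oo[ g)
  (g_0 : g 0 = 0)
  (g_gt0 : forall s, 0 < s -> 0 < g s)
  (dg_0 : derive_on `[0, +oo[ g 0 = 0)
  (dg_oo : R) (dg_lim : derive_on `[0, +oo[ g s @[s --> +oo] --> dg_oo)
  (dg_oo_gt0 : 0 < dg_oo) :
  exists2 nu_star : R, 0 < nu_star &
    forall nu : R, nu_star < nu ->
      exists u : R -> R,
        positive_solution bc T (fun x s => nu * a x * g s) u.
Proof.
have [b [bL b0 b_ge0 ab intE]] := borel_version a_int a_ge0.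
have b_neg : int_oc b 0 T < 0.
  rewrite /int_oc Rintegral_itv_obnd_cbnd; last exact: integrableS bL.
  by rewrite -intE.
have b_pos : 0 < \int[lebesgue_measure]_(x in [set` J]) b x by rewrite -intE.
have [p [p' [q' [q [[p0 pp' p'q' q'q qT] b_ge0' b_pos']]]]] :=
  interior_window bL J_sub b_pos b_ge0.
have [L L0 GL] := truncation_lipschitz g_C1 dg_lim.
have [c [M [c0 M0 GM]]] := truncation_large g_C1 g_gt0 dg_lim dg_oo_gt0.
have [nu0 nu00 H] := shooting_threshold bL T_gt0 b0 b_neg p0 pp' p'q' q'q qT
  b_ge0' b_pos' L0 GL (truncation_le0 g_0) (truncation_gt0 g_gt0)
  (truncation_small g_C1 dg_0) c0 M0 GM.
exists nu0 => // nu nu_gt; have [u [v [suv upos bdry]]] := H nu nu_gt bc.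
exists u; exact: (sol_positive_solution T_gt0 L0 bL b0 ab GL suv upos bdry).
Qed.
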